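(* Let $(\Omega,\mathscr{H},\widehat{\mathbb E})$ be a sub-linear expectation space with conjugate expectation $\widehat{\mathcal E}$, generated capacity $\mathbb V$ and outer capacity $\mathbb V^*$. Let $\{X_n;n\ge1\}$ be a sequence of identically distributed random variables in $(\Omega,\mathscr{H},\widehat{\mathbb E})$ and $S_n=\sum_{k=1}^nX_k$. (a) Suppose that $X_1,X_2,\ldots$ are negatively dependent with $C_{\mathbb V}[|X_1|]<\infty$ and $\lim_{c\to\infty}\widehat{\mathbb E}[(|X_1|-c)^+]=0$. Then $$\mathbb V^*\Big(\Big\{\liminf_{n\to\infty}\frac{S_n}{n}<\widehat{\mathcal E}[X_1]\Big\}\cup\Big\{\limsup_{n\to\infty}\frac{S_n}{n}>\widehat{\mathbb E}[X_1]\Big\}\Big)=0.$$ (b) Suppose that $X_1,X_2,\ldots$ are independent, $\mathbb V^*$ is continuous and $\widehat{\mathbb E}$ is countably sub-additive. If $$\mathbb V^*\Big(\limsup_{n\to\infty}\frac{|S_n|}{n}=+\infty\Big)<1,$$ then $C_{\mathbb V}[|X_1|]<\infty$.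
   Context: Let $(\Omega,\mathcal F)$ be a measurable space. $C_{l,Lip}(\mathbb R^n)$ is the linear space of functions $\varphi:\mathbb R^n\to\mathbb R$ such that $|\varphi(x)-\varphi(y)|\le C(1+|x|^m+|y|^m)|x-y|$ for all $x,y\in\mathbb R^n$, for some $C>0$, $m\in\mathbb N$ depending on $\varphi$. $\mathscr H$ is a linear space of real ($\mathcal F$-measurable) functions on $(\Omega,\mathcal F)$ (called random variables) such that $X_1,\ldots,X_n\in\mathscr H$ implies $\varphi(X_1,\ldots,X_n)\in\mathscr H$ for every $\varphi\in C_{l,Lip}(\mathbb R^n)$. A sub-linear expectation on $\mathscr H$ is a functional $\widehat{\mathbb E}:\mathscr H\to[-\infty,\infty]$ such that for all $X,Y\in\mathscr H$: (a) $X\ge Y$ implies $\widehat{\mathbb E}[X]\ge\widehat{\mathbb E}[Y]$; (b) $\widehat{\mathbb E}[c]=c$ for constants $c$; (c) $\widehat{\mathbb E}[X+Y]\le\widehat{\mathbb E}[X]+\widehat{\mathbb E}[Y]$ whenever the right side is not of the form $+\infty-\infty$ or $-\infty+\infty$; (d) $\widehat{\mathbb E}[\lambda X]=\lambda\widehat{\mathbb E}[X]$ for $\lambda\ge0$. The triple $(\Omega,\mathscr H,\widehat{\mathbb E})$ is called a sub-linear expectation space. The conjugate expectation is $\widehat{\mathcal E}[X]:=-\widehat{\mathbb E}[-X]$. A sub-linear expectation $\widehat{\mathbb E}:\mathscr H\to\mathbb R$ is called countably sub-additive if $\widehat{\mathbb E}[X]\le\sum_{n=1}^\infty\widehat{\mathbb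 E}[X_n]$ whenever $X\le\sum_{n=1}^\infty X_n$ with $X,X_n\in\mathscr H$, $X\ge0$, $X_n\ge0$. Independence (not symmetric): a random vector $\mathbf Y=(Y_1,\ldots,Y_n)$, $Y_i\in\mathscr H$, is independent to $\mathbf X=(X_1,\ldots,X_m)$, $X_i\in\mathscr H$, if for each $\varphi\in C_{l,Lip}(\mathbb R^m\times\mathbb R^n)$ one has $\widehat{\mathbb E}[\varphi(\mathbf X,\mathbf Y)]=\widehat{\mathbb E}\big[\widehat{\mathbb E}[\varphi(\mathbf x,\mathbf Y)]\big|_{\mathbf x=\mathbf X}\big]$ whenever $\overline\varphi(\mathbf x):=\widehat{\mathbb E}[|\varphi(\mathbf x,\mathbf Y)|]<\infty$ for all $\mathbf x$ and $\widehat{\mathbb E}[|\overline\varphi(\mathbf X)|]<\infty$. Negative dependence: $\mathbf Y=(Y_1,\ldots,Y_n)$, $Y_i\in\mathscr H$, is negatively dependent to $\mathbf X=(X_1,\ldots,X_m)$, $X_i\in\mathscr H$, if for each pair $\varphi_1\in C_{l,Lip}(\mathbb R^m)$, $\varphi_2\in C_{l,Lip}(\mathbb R^n)$ one has $\widehat{\mathbb E}[\varphi_1(\mathbf X)\varphi_2(\mathbf Y)]\le\widehat{\mathbb E}[\varphi_1(\mathbf X)]\,\widehat{\mathbb E}[\varphi_2(\mathbf Y)]$ whenever $\varphi_1(\mathbf X)\ge0$, $\widehat{\mathbb E}[\varphi_2(\mathbf Y)]\ge0$, $\widehat{\mathbb E}[|\varphi_1(\mathbf X)\varphi_2(\mathbf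 Y)|]<\infty$, $\widehat{\mathbb E}[|\varphi_1(\mathbf X)|]<\infty$, $\widehat{\mathbb E}[|\varphi_2(\mathbf Y)|]<\infty$, and either $\varphi_1,\varphi_2$ are both coordinatewise nondecreasing or both coordinatewise non-increasing. A sequence $\{X_n;n\ge1\}$ in $\mathscr H$ is called independent (resp. negatively dependent) if $X_{i+1}$ is independent (resp. negatively dependent) to $(X_1,\ldots,X_i)$ for each $i\ge1$. It is identically distributed if for each $i\ge1$, $\widehat{\mathbb E}[\varphi(X_i)]=\widehat{\mathbb E}[\varphi(X_1)]$ for all $\varphi\in C_{l,Lip}(\mathbb R)$ whenever the sub-linear expectations are finite. The generated capacity is $\mathbb V(A):=\inf\{\widehat{\mathbb E}[\xi]: I_A\le\xi,\ \xi\in\mathscr H\}$, $A\in\mathcal F$; the outer capacity is $\mathbb V^*(A):=\inf\{\sum_{n=1}^\infty\mathbb V(A_n): A\subset\bigcup_{n=1}^\infty A_n\}$, $A\in\mathcal F$ (with $A_n\in\mathcal F$). The Choquet integral is $C_{\mathbb V}[X]=\int_0^\infty\mathbb V(X\ge t)\,dt+\int_{-\infty}^0[\mathbb V(X\ge t)-1]\,dt$. A capacity $V:\mathcal F\to[0,1]$ is continuous if it is continuous from below ($V(A_n)\uparrow V(A)$ whenever $A_n\uparrow A$, $A_n,A\in\mathcal F$) and continuous from above ($V(A_n)\downarrow V(A)$ whenever $A_n\downarrow A$, $A_n,A\in\mathcal F$). $x^+=\max(x,0)$. *)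

(* Defs.v *)
From mathcomp Require Export all_boot all_order all_algebra.
From mathcomp Require Export all_classical all_reals all_analysis.
Export Order.TTheory GRing.Theory Num.Theory numFieldNormedType.Exports.

Set Implicit Arguments.
Unset Strict Implicit.
Unset Printing Implicit Defensive.

Local Open Scope classical_set_scope.
Local Open Scope ring_scope.
Local Open Scope ereal_scope.

(* The norm that the library puts on 'rV[R]_n is the sup norm. *)
Definition enorm (R : realType) (n : nat) (x : 'rV[R]_n) : R :=
  Num.sqrt (\sum_(i < n) x ord0 i ^+ 2)%R.

Definition cl_lip (R : realType) (n : nat) (phi : 'rV[R]_n -> R) : Prop :=
  exists (C : R) (m : nat), (0 < C)%R /\
    forall x y : 'rV[R]_n,
      (`|phi x - phi y| <=
         C * (1 + enorm x ^+ m + enorm y ^+ m) * enorm (x - y))%R.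

Definition rvec (R : realType) (T : Type) (n : nat) (X : 'I_n -> T -> R)
    (w : T) : 'rV[R]_n := \row_(i < n) X i w.

Record rv_space (R : realType) (d : measure_display) (T : measurableType d)
    (H : set (T -> R)) : Prop := {
  rv_measurable : forall X, H X -> measurable_fun [set: T] X ;
  rv_zero : H (fun=> 0%R) ;
  rv_add : forall X Y, H X -> H Y -> H (fun w => X w + Y w)%R ;
  rv_scale : forall (a : R) X, H X -> H (fun w => a * X w)%R ;
  rv_lip : forall (n : nat) (X : 'I_n -> T -> R) (phi : 'rV[R]_n -> R),
    (forall i, H (X i)) -> cl_lip phi -> H (fun w => phi (rvec X w))
}.

(* A functional on H is encoded as a total function on T -> R whose values
   outside H are irrelevant: everything below evaluates it on H only. *)
Record sublinear_expectation (R : realType) (T : Type) (H : set (T -> R))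
    (E : (T -> R) -> \bar R) : Prop := {
  sle_mono : forall X Y, H X -> H Y -> (forall w, (Y w <= X w)%R) -> E Y <= E X ;
  sle_cst : forall c : R, E (fun=> c) = c%:E ;
  sle_add : forall X Y, H X -> H Y -> E X +? E Y ->
    E (fun w => X w + Y w)%R <= E X + E Y ;
  sle_scale : forall (a : R) X, H X -> (0 <= a)%R ->
    E (fun w => a * X w)%R = a%:E * E X
}.

Record sublinear_expectation_space (R : realType) (d : measure_display)
    (T : measurableType d) (H : set (T -> R)) (E : (T -> R) -> \bar R)
    : Prop := {
  sles_rv : rv_space H ;
  sles_sle : sublinear_expectation H E
}.

Definition conj_expectation (R : realType) (T : Type)
    (E : (T -> R) -> \bar R) (X : T -> R) : \bar R :=
  - E (fun w => - X w)%R.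

(* E may take infinite values here: if E were finite on H, all moments of all
   elements of H would be finite and so would be their Choquet integrals. *)
Definition countably_subadditive (R : realType) (T : Type) (H : set (T -> R))
    (E : (T -> R) -> \bar R) : Prop :=
  forall (X : T -> R) (Xs : nat -> T -> R),
    H X -> (forall n, H (Xs n)) ->
    (forall w, (0 <= X w)%R) -> (forall n w, (0 <= Xs n w)%R) ->
    (forall w, (X w)%:E <= \sum_(n <oo) (Xs n w)%:E) ->
    E X <= \sum_(n <oo) E (Xs n).

(* phibar dominates |E[phi(x, Y)]|, so fine loses nothing once phibar is
   finite.  The functions x |-> phibar x and x |-> E[phi(x, Y)] need not be in
   C_{l,Lip}, hence their values at X need not be in H; the product rule is
   required exactly when both outer expectations are those of elements of H. *)
Definition independent_to (R : realType) (T : Type) (H : set (T -> R))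
    (E : (T -> R) -> \bar R) (m n : nat)
    (X : 'I_m -> T -> R) (Y : 'I_n -> T -> R) : Prop :=
  forall phi : 'rV[R]_(m + n) -> R, cl_lip phi ->
    let phibar (x : 'rV[R]_m) := E (fun w => `|phi (row_mx x (rvec Y w))|%R) in
    let g (x : 'rV[R]_m) := E (fun w => phi (row_mx x (rvec Y w))) in
    (forall x, phibar x < +oo) ->
    H (fun w => fine (phibar (rvec X w))) ->
    H (fun w => fine (g (rvec X w))) ->
    E (fun w => `|fine (phibar (rvec X w))|%R) < +oo ->
    E (fun w => phi (row_mx (rvec X w) (rvec Y w))) =
    E (fun w => fine (g (rvec X w))).

Definition coord_nondecreasing (R : realType) (n : nat) (phi : 'rV[R]_n -> R) :=
  forall x y : 'rV[R]_n,
    (forall i, (x ord0 i <= y ord0 i)%R) -> (phi x <= phi y)%R.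

Definition coord_nonincreasing (R : realType) (n : nat) (phi : 'rV[R]_n -> R) :=
  forall x y : 'rV[R]_n,
    (forall i, (x ord0 i <= y ord0 i)%R) -> (phi y <= phi x)%R.

Definition neg_dependent_to (R : realType) (T : Type)
    (E : (T -> R) -> \bar R) (m n : nat)
    (X : 'I_m -> T -> R) (Y : 'I_n -> T -> R) : Prop :=
  forall (phi1 : 'rV[R]_m -> R) (phi2 : 'rV[R]_n -> R),
    cl_lip phi1 -> cl_lip phi2 ->
    (forall w, (0 <= phi1 (rvec X w))%R) ->
    0 <= E (fun w => phi2 (rvec Y w)) ->
    E (fun w => `|phi1 (rvec X w) * phi2 (rvec Y w)|%R) < +oo ->
    E (fun w => `|phi1 (rvec X w)|%R) < +oo ->
    E (fun w => `|phi2 (rvec Y w)|%R) < +oo ->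
    (coord_nondecreasing phi1 /\ coord_nondecreasing phi2) \/
    (coord_nonincreasing phi1 /\ coord_nonincreasing phi2) ->
    E (fun w => phi1 (rvec X w) * phi2 (rvec Y w))%R <=
    E (fun w => phi1 (rvec X w)) * E (fun w => phi2 (rvec Y w)).

(* Sequences are indexed from 0: X 0, X 1, ... stand for X_1, X_2, ... *)
Definition independent_seq (R : realType) (T : Type) (H : set (T -> R))
    (E : (T -> R) -> \bar R) (X : nat -> T -> R) : Prop :=
  forall i : nat,
    independent_to H E (fun j : 'I_i.+1 => X j) (fun _ : 'I_1 => X i.+1).

Definition neg_dependent_seq (R : realType) (T : Type)
    (E : (T -> R) -> \bar R) (X : nat -> T -> R) : Prop :=
  forall i : nat,
    neg_dependent_to E (fun j : 'I_i.+1 => X j) (fun _ : 'I_1 => X i.+1).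

Definition identically_distributed (R : realType) (T : Type)
    (E : (T -> R) -> \bar R) (X : nat -> T -> R) : Prop :=
  forall (i : nat) (phi : 'rV[R]_1 -> R), cl_lip phi ->
    let Ephi j := E (fun w => phi (rvec (fun _ : 'I_1 => X j) w)) in
    Ephi i \is a fin_num -> Ephi 0%N \is a fin_num -> Ephi i = Ephi 0%N.

Definition capacity (R : realType) (T : Type) (H : set (T -> R))
    (E : (T -> R) -> \bar R) (A : set T) : \bar R :=
  ereal_inf [set E xi | xi in [set xi | H xi /\ forall w, (\1_A w <= xi w)%R]].

(* mu_ext is the infimum of \sum_n (capacity H E (F n)) over the countable
   covers of A by measurable sets F n. *)
Definition outer_capacity (R : realType) (d : measure_display)
    (T : measurableType d) (H : set (T -> R)) (E : (T -> R) -> \bar R)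
    (A : set T) : \bar R :=
  mu_ext (capacity H E : set T -> \bar R) A.

Definition choquet (R : realType) (T : Type) (V : set T -> \bar R)
    (X : T -> R) : \bar R :=
  \int[lebesgue_measure]_(t in `[0%R, +oo[) V [set w | (t <= X w)%R] +
  \int[lebesgue_measure]_(t in `]-oo, 0%R]) (V [set w | (t <= X w)%R] - 1).

Definition continuous_from_below (R : realType) (d : measure_display)
    (T : measurableType d) (V : set T -> \bar R) : Prop :=
  forall F : nat -> set T, (forall n, measurable (F n)) ->
    nondecreasing_seq F -> V (F n) @[n --> \oo] --> V (\bigcup_n F n).

Definition continuous_from_above (R : realType) (d : measure_display)
    (T : measurableType d) (V : set T -> \bar R) : Prop :=
  forall F : nat -> set T, (forall n, measurable (F n)) ->
    nonincreasing_seq F -> V (F n) @[n --> \oo] --> V (\bigcap_n F n).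

Definition continuous_capacity (R : realType) (d : measure_display)
    (T : measurableType d) (V : set T -> \bar R) : Prop :=
  continuous_from_below V /\ continuous_from_above V.

Definition psum (R : realType) (T : Type) (X : nat -> T -> R) (n : nat)
    (w : T) : R := (\sum_(k < n) X k w)%R.

(* Main.v *)
Require Import Defs.
From mathcomp Require Import measurable_realfun ring lra.

(** Everything rests on a few regular functions of the variables: the clipping
    [clip c] at level [c] and the Lipschitz cutoff [gate c] of the event
    [c <= |x|]. They are bounded, hence have finite expectations that are the
    same for all the variables. The Choquet integral enters only through the
    tail sums of [mean (gate c (X 0))], by comparison of an integral of a
    nonincreasing function with a sum ([sum_mean_gate_bounded] and
    [choquet_lt_pinfty]).

    Direct part. Negative dependence bounds the expectation of a product of a
    nonnegative nondecreasing function of the past and of a nondecreasing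
    function of the next variable. Lindley's recursion
    [L n.+1 = max (L n + Z n) 0] has this shape when [Z n] is the clipped and
    centred variable, and [L n] is the maximum of the backward sums
    [Z m + ... + Z n.-1] over [m <= n]. Since the cross term [L n * Z n] has
    nonpositive mean, [L n] satisfies the second moment bound of a sum of
    uncorrelated variables ([mean_lindley_sqr_le]). For [n = q * 2 ^ j] and
    clipping at level [n], finiteness of the Choquet integral makes the
    capacities of the events that clipping matters or that [L n] exceeds
    [eps * n] summable in [j]; the first Borel-Cantelli lemma, which holds for
    the outer capacity because that is countably subadditive by construction,
    makes them negligible in the limit ([deviation_null]).

    It remains to pass from the indices [q * 2 ^ j] to all [m]. Take [n] of this
    form slightly above [m] ([dyadic_approx]) and write the partial sum up to
    [m] as the partial sum up to [n] plus the backward sum of the opposite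
    variables between [m] and [n]. The first is controlled by the bound for [X],
    the second one by the bound for [- X], which is again negatively dependent;
    its drift is at most [(n - m) * mean |X 0|], a small fraction of [m]
    ([partial_sum_le]). This gives the bound for the upper limit, and the bound
    for the lower limit is the same statement for [- X].

    Converse part. For independent variables the conjugate expectation is
    multiplicative on products of nonnegative functions
    ([independent_mean_prod]). If the Choquet integral is infinite, the tail sums
    diverge, so that [1 - \prod (1 - gate)] has means tending to 1. Countable
    subadditivity of the expectation turns this into a lower bound for the outer
    capacity of the events [large_from m] that [|X n|] exceeds [(m + 1) * n] for
    some [n > m] ([mean_le_outer_capacity]). Continuity from above then gives
    outer capacity at least 1 to their intersection, on which the averages are unbounded
    because [X n] is a difference of consecutive partial sums. *)

Set Implicit Arguments.
Unset Strict Implicit.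
Unset Printing Implicit Defensive.

Local Open Scope classical_set_scope.
Local Open Scope ring_scope.

(** * Lipschitz functions *)

Definition lipR (R : realType) (f : R -> R) : Prop :=
  exists C : R, forall x y, `|f x - f y| <= C * `|x - y|.

Section Lipschitz.
Context {R : realType}.
Implicit Types f g : R -> R.

Lemma lipR_ge0 f : lipR f ->
  exists2 C : R, 0 <= C & forall x y, `|f x - f y| <= C * `|x - y|.
Proof.
move=> [C fC]; exists `|C| => // x y; apply: le_trans (fC x y) _.
by rewrite ler_wpM2r// ler_norm.
Qed.

Lemma lipR_id : lipR (fun x : R => x).
Proof. by exists 1 => x y; rewrite mul1r. Qed.

Lemma lipR_cst (c : R) : lipR (fun=> c).
Proof. by exists 0 => x y; rewrite subrr normr0 mul0r. Qed.

Lemma lipR_add f g : lipR f -> lipR g -> lipR (fun x => f x + g x).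
Proof.
move=> [C fC] [D gD]; exists (C + D) => x y.
rewrite opprD addrACA mulrDl (le_trans (ler_normD _ _))//.
exact: lerD.
Qed.

Lemma lipR_scale (a : R) f : lipR f -> lipR (fun x => a * f x).
Proof.
move=> [C fC]; exists (`|a| * C) => x y.
by rewrite -mulrBr normrM -mulrA ler_wpM2l.
Qed.

Lemma lipR_norm f : lipR f -> lipR (fun x => `|f x|).
Proof.
move=> [C fC]; exists C => x y.
exact: le_trans (ler_dist_dist _ _) (fC x y).
Qed.

Lemma ler_dist_max (a b c : R) : `|Num.max a c - Num.max b c| <= `|a - b|.
Proof.
by rewrite /Num.max; case: ltP => h1; case: ltP => h2;
  rewrite ler_norml; apply/andP; split; case: (ger0P (a - b)) => h3; lra.
Qed.

Lemma lipR_max f (c : R) : lipR f -> lipR (fun x => Num.max (f x) c).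
Proof.
by move=> [C fC]; exists C => x y; exact: le_trans (ler_dist_max _ _ _) (fC _ _).
Qed.

Lemma ler_dist_min (a b c : R) : `|Num.min a c - Num.min b c| <= `|a - b|.
Proof.
by rewrite /Num.min; case: ltP => h1; case: ltP => h2;
  rewrite ler_norml; apply/andP; split; case: (ger0P (a - b)) => h3; lra.
Qed.

Lemma lipR_min f (c : R) : lipR f -> lipR (fun x => Num.min (f x) c).
Proof.
by move=> [C fC]; exists C => x y; exact: le_trans (ler_dist_min _ _ _) (fC _ _).
Qed.

Lemma lipR_sqr f (B : R) : (forall x, `|f x| <= B) -> lipR f ->
  lipR (fun x => f x ^+ 2).
Proof.
move=> fB /lipR_ge0[C C0 fC]; exists ((B + B) * C) => x y.
rewrite subr_sqr normrM mulrC -mulrA ler_pM//.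
by rewrite (le_trans (ler_normD _ _))// lerD.
Qed.

Lemma coord_le_enorm n (x : 'rV[R]_n) i : `|x ord0 i| <= enorm x.
Proof.
rewrite -sqrtr_sqr ler_wsqrtr// (bigD1 i)//= lerDl sumr_ge0// => j _.
exact: sqr_ge0.
Qed.

Lemma enorm_ge0 n (x : 'rV[R]_n) : 0 <= enorm x.
Proof. exact: sqrtr_ge0. Qed.

Lemma enormN n (x : 'rV[R]_n) : enorm (- x) = enorm x.
Proof. by congr Num.sqrt; apply: eq_bigr => i _; rewrite mxE sqrrN. Qed.

(** The sum of the coordinate distances dominates the Euclidean distance up to
    a factor [n], so coordinatewise estimates suffice. *)
Lemma cl_lip_coord n (phi : 'rV[R]_n -> R) (C : R) :
  (forall x y, `|phi x - phi y| <= C * \sum_i `|x ord0 i - y ord0 i|) ->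
  cl_lip phi.
Proof.
move=> phiC; exists (`|C| * n%:R + 1), 0%N; split.
  by rewrite ltr_wpDl// mulr_ge0.
move=> x y; apply: le_trans (phiC x y) _.
have -> : \sum_i `|x ord0 i - y ord0 i| = \sum_i `|(x - y) ord0 i|.
  by apply: eq_bigr => i _; rewrite !mxE.
have le_sum : \sum_i `|(x - y) ord0 i| <= n%:R * enorm (x - y).
  rewrite -[n in n%:R]card_ord mulr_natl -sumr_const.
  by apply: ler_sum => i _; exact: coord_le_enorm.
rewrite !expr0.
have C0 : 0 <= `|C| * n%:R * enorm (x - y).
  by rewrite !mulr_ge0// enorm_ge0.
have e0 := enorm_ge0 (x - y).
apply: (@le_trans _ _ (`|C| * n%:R * enorm (x - y))); last first.
  by move: C0 e0; set a := `|C| * n%:R; set b := enorm _ => C0 e0; lra.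
rewrite -mulrA (le_trans (ler_wpM2r _ (ler_norm C)))//.
  by rewrite sumr_ge0.
by rewrite ler_wpM2l.
Qed.

Lemma cl_lip_opp n (phi : 'rV[R]_n -> R) : cl_lip phi ->
  cl_lip (fun x => phi (- x)).
Proof.
move=> [C [m [C0 phiC]]]; exists C, m; split => // x y.
by have := phiC (- x) (- y); rewrite -opprD !enormN.
Qed.

Lemma cl_lip1 f : lipR f -> cl_lip (fun x : 'rV[R]_1 => f (x ord0 ord0)).
Proof.
move=> [C fC]; apply: (@cl_lip_coord _ _ C) => x y.
by rewrite big_ord_recl big_ord0 addr0.
Qed.

Lemma cl_lip_sqr : cl_lip (fun x : 'rV[R]_1 => x ord0 ord0 ^+ 2).
Proof.
exists 1, 1%N; split => // x y; rewrite subr_sqr normrM mulrC mul1r !expr1.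
rewrite ler_pM//; last by have := coord_le_enorm (x - y) ord0; rewrite !mxE.
rewrite (le_trans (ler_normD _ _))//.
have := coord_le_enorm x ord0; have := coord_le_enorm y ord0; lra.
Qed.

End Lipschitz.

(** * Calculus of sublinear expectations *)

Section SublinearCalculus.
Context {R : realType} {d : measure_display} {T : measurableType d}.
Context {H : set (T -> R)} {E : (T -> R) -> \bar R}.
Context (hE : sublinear_expectation_space H E).
Implicit Types X Y : T -> R.

Let hS := sles_sle hE.
Let hH := sles_rv hE.

Lemma rv_cst (c : R) : H (fun=> c).
Proof.
apply: (@rv_lip _ _ _ _ hH 0 (fun _ _ => 0) (fun=> c)) => [[]//|].
by apply: (@cl_lip_coord _ _ _ 0) => x y; rewrite subrr normr0 mul0r.
Qed.

Lemma rv_lipR f X : H X -> lipR f -> H (fun w => f (X w)).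
Proof.
move=> HX /cl_lip1 lf.
have := @rv_lip _ _ _ _ hH 1 (fun=> X) _ (fun=> HX) lf.
by congr (H _); apply/funext => w; rewrite mxE.
Qed.

Lemma rv_opp X : H X -> H (fun w => - X w).
Proof.
move=> HX; have := rv_scale hH (-1) HX.
by congr (H _); apply/funext => w; rewrite mulN1r.
Qed.

Lemma rv_sub X Y : H X -> H Y -> H (fun w => X w - Y w).
Proof. by move=> HX /rv_opp HY; exact: rv_add. Qed.

Lemma rv_norm X : H X -> H (fun w => `|X w|).
Proof. by move=> HX; apply: (rv_lipR HX); exact/lipR_norm/lipR_id. Qed.

Lemma rv_sqr X : H X -> H (fun w => X w ^+ 2).
Proof.
move=> HX.
have := @rv_lip _ _ _ _ hH 1 (fun=> X) _ (fun=> HX) cl_lip_sqr.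
by congr (H _); apply/funext => w; rewrite mxE.
Qed.

(** Polarisation: squares are available since they are locally Lipschitz. *)
Lemma rv_mul X Y : H X -> H Y -> H (fun w => X w * Y w).
Proof.
move=> HX HY.
have HD : H (fun w => (X w + Y w) ^+ 2) by exact/rv_sqr/(rv_add hH).
have HB : H (fun w => (X w - Y w) ^+ 2) by exact/rv_sqr/rv_sub.
have := rv_scale hH (4^-1) (rv_sub HD HB).
by congr (H _); apply/funext => w; field.
Qed.

Lemma rv_prod n (F : nat -> T -> R) : (forall k, H (F k)) ->
  H (fun w => \prod_(k < n) F k w).
Proof.
move=> HF; elim: n => [|n IH].
  by under eq_fun do rewrite big_ord0; exact: rv_cst.
by under eq_fun do rewrite big_ord_recr/=; exact: rv_mul.
Qed.

(** Random variables on which the extended-valued functional is finite and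
    therefore truly sublinear. *)
Definition rv_L1 X := H X /\ (E (fun w => `|X w|)%R < +oo)%E.

Definition mean X : R := fine (E X).

Lemma rv_L1_H X : rv_L1 X -> H X. Proof. by case. Qed.

Lemma E_ge0 X : H X -> (forall w, 0 <= X w) -> (0 <= E X)%E.
Proof.
by move=> HX X0; rewrite -[leLHS](sle_cst hS 0); apply: (sle_mono hS) => //; exact: rv_cst.
Qed.

Lemma E_abs_fin X : rv_L1 X -> E (fun w => `|X w|) \is a fin_num.
Proof.
by move=> [HX Xoo]; rewrite ge0_fin_numE//; apply: E_ge0 => //; exact: rv_norm.
Qed.

(** The lower bound comes from [0 = E 0 <= E |X| + E (- |X|)]. *)
Lemma E_fin X : rv_L1 X -> E X \is a fin_num.
Proof.
move=> LX; have [HX Xoo] := LX; have HaX := rv_norm HX.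
have aF := E_abs_fin LX.
rewrite fin_numE; apply/andP; split; last first.
  rewrite -ltey; apply: le_lt_trans Xoo.
  by apply: (sle_mono hS) => // w; exact: ler_norm.
rewrite -ltNye; apply: (@lt_le_trans _ _ (E (fun w => - `|X w|))); last first.
  apply: (sle_mono hS) => //; first exact: rv_opp.
  by move=> w; rewrite lerNl -normrN ler_norm.
have := sle_add hS HaX (rv_opp HaX).
rewrite fin_num_adde_defr// => /(_ isT).
under eq_fun do rewrite subrr.
rewrite (sle_cst hS) ltNye; case: (E (fun w => - _)) => //.
by rewrite addeNy.
Qed.

Lemma meanE X : rv_L1 X -> E X = (mean X)%:E.
Proof. by move=> /E_fin/fineK. Qed.

Lemma rv_L1_le X Y : H X -> (forall w, `|X w| <= Y w) -> rv_L1 Y -> rv_L1 X.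
Proof.
move=> HX XY [HY Yoo]; split => //; apply: le_lt_trans Yoo.
apply: (sle_mono hS); [exact: rv_norm..|] => w.
by rewrite (le_trans (XY w))// ler_norm.
Qed.

Lemma rv_L1_cst c : rv_L1 (fun=> c).
Proof. by split; [exact: rv_cst|rewrite (sle_cst hS) ltry]. Qed.

Lemma rv_L1_bounded X M : H X -> (forall w, `|X w| <= M) -> rv_L1 X.
Proof. by move=> HX XM; apply: rv_L1_le (rv_L1_cst M). Qed.

Lemma rv_L1_norm X : rv_L1 X -> rv_L1 (fun w => `|X w|).
Proof.
by move=> [HX Xoo]; split; [exact: rv_norm|under eq_fun do rewrite normr_id].
Qed.

Lemma rv_L1_add X Y : rv_L1 X -> rv_L1 Y -> rv_L1 (fun w => X w + Y w).
Proof.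
move=> LX LY; have [HX Xoo] := LX; have [HY Yoo] := LY.
split; first exact: rv_add.
apply: (@le_lt_trans _ _ (E (fun w => `|X w| + `|Y w|))).
  apply: (sle_mono hS); last by move=> w; exact: ler_normD.
    exact/(rv_add hH)/rv_norm/HY/rv_norm.
  exact/rv_norm/(rv_add hH).
apply: le_lt_trans (lte_add_pinfty Xoo Yoo); apply: (sle_add hS).
- exact: rv_norm.
- exact: rv_norm.
- exact/fin_num_adde_defr/E_abs_fin.
Qed.

Lemma rv_L1_scale a X : rv_L1 X -> rv_L1 (fun w => a * X w).
Proof.
move=> LX; have [HX Xoo] := LX; split; first exact: rv_scale.
under eq_fun do rewrite normrM.
rewrite (sle_scale hS)//; last exact: rv_norm.
by rewrite -(fineK (E_abs_fin LX)) -EFinM ltry.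
Qed.

Lemma rv_L1_opp X : rv_L1 X -> rv_L1 (fun w => - X w).
Proof.
by move=> [HX Xoo]; split; [exact: rv_opp|under eq_fun do rewrite normrN].
Qed.

Lemma rv_L1_sub X Y : rv_L1 X -> rv_L1 Y -> rv_L1 (fun w => X w - Y w).
Proof. by move=> LX /rv_L1_opp; exact: rv_L1_add. Qed.

Lemma rv_L1_sum n (F : nat -> T -> R) : (forall k, rv_L1 (F k)) ->
  rv_L1 (fun w => \sum_(k < n) F k w).
Proof.
move=> HF; elim: n => [|n IH].
  by under eq_fun do rewrite big_ord0; exact: rv_L1_cst.
by under eq_fun do rewrite big_ord_recr/=; exact: rv_L1_add.
Qed.

Lemma mean_le X Y : rv_L1 X -> rv_L1 Y -> (forall w, X w <= Y w) ->
  mean X <= mean Y.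
Proof.
move=> LX LY XY; rewrite -lee_fin -!meanE//.
by apply: (sle_mono hS) => //; exact: rv_L1_H.
Qed.

Lemma mean_cst c : mean (fun=> c) = c.
Proof. by rewrite /mean (sle_cst hS). Qed.

Lemma mean_ge0 X : rv_L1 X -> (forall w, 0 <= X w) -> 0 <= mean X.
Proof. by move=> LX X0; rewrite -(mean_cst 0) mean_le//; exact: rv_L1_cst. Qed.

Lemma mean_le_cst X c : rv_L1 X -> (forall w, X w <= c) -> mean X <= c.
Proof. by move=> LX Xc; rewrite -(mean_cst c) mean_le//; exact: rv_L1_cst. Qed.

Lemma mean_add X Y : rv_L1 X -> rv_L1 Y ->
  mean (fun w => X w + Y w) <= mean X + mean Y.
Proof.
move=> LX LY; rewrite -lee_fin EFinD -!meanE//; last exact: rv_L1_add.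
by apply: (sle_add hS); [exact: rv_L1_H..|exact/fin_num_adde_defr/E_fin].
Qed.

Lemma mean_scale a X : 0 <= a -> rv_L1 X -> mean (fun w => a * X w) = a * mean X.
Proof.
move=> a0 LX; apply: EFin_inj; rewrite EFinM -!meanE//; last exact: rv_L1_scale.
by rewrite (sle_scale hS)//; exact: rv_L1_H.
Qed.

Lemma mean_sum n (F : nat -> T -> R) : (forall k, rv_L1 (F k)) ->
  mean (fun w => \sum_(k < n) F k w) <= \sum_(k < n) mean (F k).
Proof.
move=> LF; elim: n => [|n IH].
  by rewrite big_ord0; under eq_fun do rewrite big_ord0; rewrite mean_cst.
rewrite big_ord_recr/=; under eq_fun do rewrite big_ord_recr/=.
apply: le_trans (mean_add _ _) _ => //; first exact: rv_L1_sum.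
by rewrite lerD2r.
Qed.

(** Constants are translated exactly: subadditivity is used for [c] and for
    [- c]. *)
Lemma mean_addc X c : rv_L1 X -> mean (fun w => X w + c) = mean X + c.
Proof.
move=> LX; have Lc := rv_L1_cst c; have LNc := rv_L1_cst (- c).
apply/le_anti/andP; split.
  by have := mean_add LX Lc; rewrite mean_cst.
have := mean_add (rv_L1_add LX Lc) LNc; rewrite mean_cst.
by under eq_fun do rewrite addrK; rewrite lerBrDr.
Qed.

Lemma mean_oppr X : rv_L1 X -> - mean (fun w => - X w) <= mean X.
Proof.
move=> LX; have := mean_add LX (rv_L1_opp LX).
by under eq_fun do rewrite subrr; rewrite mean_cst; lra.
Qed.

Lemma mean_sub X Y : rv_L1 X -> rv_L1 Y ->
  mean X - mean Y <= mean (fun w => X w - Y w).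
Proof.
move=> LX LY; have := mean_add (rv_L1_sub LX LY) LY.
by under eq_fun do rewrite subrK; rewrite lerBlDr.
Qed.

Lemma abs_mean_le X : rv_L1 X -> `|mean X| <= mean (fun w => `|X w|).
Proof.
move=> LX; have LaX := rv_L1_norm LX; rewrite ler_norml; apply/andP; split.
  apply: (@le_trans _ _ (- mean (fun w => - X w))); last exact: mean_oppr.
  rewrite lerN2; apply: mean_le => //; first exact: rv_L1_opp.
  by move=> w; rewrite -normrN ler_norm.
by apply: mean_le => // w; exact: ler_norm.
Qed.

(** * Capacity and outer capacity *)

Local Notation V := (capacity H E).
Local Notation Vext := (outer_capacity H E).

Lemma capacity_le A X : H X -> (forall w, \1_A w <= X w) -> (V A <= E X)%E.
Proof. by move=> HX AX; apply: ereal_inf_lbound; exists X. Qed.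

Lemma le_capacity_E A X : H X -> (forall w, X w <= \1_A w) -> (E X <= V A)%E.
Proof.
move=> HX XA; apply: le_ereal_inf_tmp => _ [Y [HY AY] <-].
by apply: (sle_mono hS) => // w; exact: le_trans (AY w).
Qed.

Lemma capacity_ge0 A : (0 <= V A)%E.
Proof.
rewrite -[leLHS](sle_cst hS 0); apply: le_capacity_E; first exact: rv_cst.
by move=> w; rewrite indicE.
Qed.

Lemma capacity_le1 A : (V A <= 1)%E.
Proof.
rewrite -[leRHS](sle_cst hS 1); apply: capacity_le; first exact: rv_cst.
by move=> w; rewrite indicE; case: (_ \in _).
Qed.

Lemma capacity_fin A : V A \is a fin_num.
Proof.
by rewrite ge0_fin_numE ?capacity_ge0// (le_lt_trans (capacity_le1 A))// ltry.
Qed.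

Lemma capacity_set0 : V set0 = 0%E.
Proof.
apply/le_anti/andP; split; last exact: capacity_ge0.
rewrite -[leRHS](sle_cst hS 0); apply: capacity_le; first exact: rv_cst.
by move=> w; rewrite indic0.
Qed.

Lemma capacity_setT : V setT = 1%E.
Proof.
apply/le_anti/andP; split; first exact: capacity_le1.
rewrite -[leLHS](sle_cst hS 1); apply: le_capacity_E; first exact: rv_cst.
by move=> w; rewrite indicT.
Qed.

Lemma le_capacity A B : A `<=` B -> (V A <= V B)%E.
Proof.
move=> AB; apply: le_ereal_inf_tmp => _ [Y [HY BY] <-].
apply: capacity_le => // w; apply: le_trans (BY w).
rewrite !indicE; have [wA|_] := boolP (w \in A); last by case: (_ \in _).
by rewrite [w \in B]mem_set//; apply: AB; rewrite inE in wA.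
Qed.

Lemma outer_capacity_ge0 A : (0 <= Vext A)%E.
Proof. exact/mu_ext_ge0/capacity_ge0. Qed.

Lemma outer_capacity_null_sub A B : A `<=` B -> Vext B = 0%E -> Vext A = 0%E.
Proof.
move=> AB B0; apply/le_anti/andP; split; last exact: outer_capacity_ge0.
by rewrite -B0; exact: le_mu_ext.
Qed.

Lemma outer_capacity_null_bigcup (F : nat -> set T) :
  (forall n, Vext (F n) = 0%E) -> Vext (\bigcup_n F n) = 0%E.
Proof.
move=> F0; apply/le_anti/andP; split; last exact: outer_capacity_ge0.
apply: le_trans (mu_ext_sigma_subadditive capacity_ge0 F) _.
by rewrite eseries0// => n _ _; exact: F0.
Qed.

Lemma outer_capacity_nullU A B : Vext A = 0%E -> Vext B = 0%E ->
  Vext (A `|` B) = 0%E.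
Proof.
move=> A0 B0; rewrite -bigcup2E; apply: outer_capacity_null_bigcup => -[|[|n]]//=.
exact/mu_ext0/capacity_ge0/capacity_set0.
Qed.

(** First Borel-Cantelli lemma, with random variables in place of events so that
    only expectations have to be summed: the event [1 <= xi n] is measurable and
    its capacity is at most the mean of [xi n]. *)
Lemma borel_cantelli (xi : nat -> T -> R) (C : R) :
  (forall n, rv_L1 (xi n)) -> (forall n w, 0 <= xi n w) ->
  (forall N, \sum_(n < N) mean (xi n) <= C) ->
  Vext [set w | forall N, exists2 n, (N <= n)%N & 1 <= xi n w] = 0%E.
Proof.
move=> L1xi xi0 xiC; set A := [set w | _].
pose F n := [set w | 1 <= xi n w].
have mF n : measurable (F n).
  rewrite -[F n]setTI; have := rv_measurable hH (rv_L1_H (L1xi n)).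
  move=> /(_ measurableT _ (measurable_itv `[1, +oo[)).
  by congr (measurable (_ `&` _)); apply/seteqP; split => w /=; rewrite in_itv/= andbT.
have VF n : (V (F n) <= (mean (xi n))%:E)%E.
  rewrite -meanE//; apply: capacity_le => [|w]; first exact: rv_L1_H.
  rewrite indicE; case: (boolP (w \in F n)) => [|_]; last exact: xi0.
  by rewrite inE.
have sumV : (\sum_(0 <= n <oo) V (F n) < +oo)%E.
  apply: (@le_lt_trans _ _ C%:E); last exact: ltry.
  apply: lime_le; first by apply: is_cvg_nneseries => n _ _; exact: capacity_ge0.
  near=> N; rewrite big_mkord.
  apply: (@le_trans _ _ (\sum_(n < N) (mean (xi n))%:E)%E); first exact: lee_sum.
  by rewrite sumEFin lee_fin.
have tail := nneseries_tail_cvg sumV (fun n _ => capacity_ge0 (F n)).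
apply/le_anti/andP; split; last exact: outer_capacity_ge0.
rewrite -(cvg_lim _ tail)//; apply: lime_ge; first exact/cvgP/tail.
near=> N; rewrite -nneseries_addn; last by move=> n; exact: capacity_ge0.
apply: ereal_inf_lbound; exists (fun n => F (n + N)%N) => //.
split; first by move=> n; exact: mF.
by move=> w /(_ N)[n Nn xin]; exists (n - N)%N => //; rewrite /F/= subnK.
Unshelve. all: by end_near. Qed.

(** Countable subadditivity of [E] lets a random variable below the indicator
    of [A] be compared with the near-optimal majorants of the sets of any
    countable cover of [A]. *)
Lemma mean_le_outer_capacity A X : countably_subadditive H E ->
  rv_L1 X -> (forall w, 0 <= X w) -> (forall w, X w <= \1_A w) ->
  ((mean X)%:E <= Vext A)%E.
Proof.
move=> sigma_sub LX X0 XA; rewrite -meanE//.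
apply: le_ereal_inf_tmp => _ [F [mF AF] <-].
apply/lee_addgt0Pr => e e0.
apply: le_trans (epsilon_trick xpredT (fun n => capacity_ge0 (F n)) (ltW e0)).
have dom n : exists Y, [/\ H Y, forall w, \1_(F n) w <= Y w &
    (E Y <= V (F n) + (e / (2 ^ n.+1)%:R)%:E)%E].
  have en0 : 0 < e / (2 ^ n.+1)%:R by rewrite divr_gt0// ltr0n expn_gt0.
  have [_ [Y [HY FY] <-] YV] := lb_ereal_inf_adherent en0 (capacity_fin (F n)).
  by exists Y; split => //; exact: ltW.
have [Y HY] := choice dom.
have Y0 n w : 0 <= Y n w.
  by have [_ FY _] := HY n; apply: le_trans (FY w); rewrite indicE.
apply: le_trans (lee_nneseries _ _).
- apply: sigma_sub => //; [exact: rv_L1_H|by move=> n; have [] := HY n|].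
  move=> w; have [wA|wA] := pselect (A w); last first.
    apply: (@le_trans _ _ 0%E); last by apply: nneseries_ge0 => n _ _; rewrite lee_fin.
    by rewrite lee_fin (le_trans (XA w))// indicE memNset.
  have [n _ Fnw] := AF w wA.
  apply: (@le_trans _ _ (Y n w)%:E).
    rewrite lee_fin (le_trans (XA w))//; have [_ FY _] := HY n.
    by apply: le_trans (FY w); rewrite !indicE !mem_set.
  rewrite (@nneseriesD1 _ _ n xpredT)//; last by move=> k _; rewrite lee_fin.
  by rewrite leeDl// nneseries_ge0// => k _ _; rewrite lee_fin.
- by move=> n _ _; apply: E_ge0 => //; have [] := HY n.
- by move=> n _; have [] := HY n.
Qed.

End SublinearCalculus.

(** * Comparison of integrals with sums *)

Section IntegralTest.
Context {R : realType}.
Implicit Types (g : R -> R) (t : nat -> R).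

Lemma trivIset_itv_nondecreasing t : nondecreasing_seq t ->
  trivIset setT (fun n => `[t n, t n.+1[%classic).
Proof.
move=> t_nd; suff lt_disj m n : (m < n)%N ->
    `[t m, t m.+1[%classic `&` `[t n, t n.+1[%classic = set0.
  apply/trivIsetP => m n _ _; rewrite neq_ltn => /orP[|]; first exact: lt_disj.
  by rewrite setIC; exact: lt_disj.
move=> mn; apply/seteqP; split => // x [] /=; rewrite !in_itv/=.
move=> /andP[_ xm] /andP[nx _]; have := t_nd _ _ mn.
by move=> /(lt_le_trans xm) /lt_le_trans /(_ nx); rewrite ltxx.
Qed.

Lemma measurable_fun_EFin_nonincreasing g (D : set R) : measurable D ->
  {homo g : x y /~ x <= y} -> measurable_fun D (EFin \o g).
Proof.
move=> mD g_ni; apply/measurable_EFinP.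
by apply: nonincreasing_measurable => // x y xy; exact: g_ni.
Qed.

Lemma integral_cst_itv (c a b : R) : a <= b ->
  (\int[lebesgue_measure]_(x in `[a, b[) c%:E = (c * (b - a))%:E)%E.
Proof.
move=> ab; rewrite integral_cst//= lebesgue_measure_itv/= lte_fin.
case: ltP => [_|ba]; first by rewrite -EFinB -EFinM.
by rewrite mule0; congr EFin; rewrite (@le_anti _ _ a b) ?ab ?ba// subrr mulr0.
Qed.

Lemma integral_ge_sum g t J : {homo g : x y /~ x <= y} -> (forall x, 0 <= g x) ->
  nondecreasing_seq t -> 0 <= t 0%N ->
  ((\sum_(j < J) g (t j.+1) * (t j.+1 - t j))%:E <=
   \int[lebesgue_measure]_(x in `[0%R, +oo[) (g x)%:E)%E.
Proof.
move=> g_ni g0 t_nd t0; pose I n := `[t n, t n.+1[%classic.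
have mI n : measurable (I n) by exact: measurable_itv.
have UI0 : \bigcup_n I n `<=` `[0, +oo[%classic.
  move=> x [n _]; rewrite /I/= !in_itv/= andbT => /andP[tx _].
  by rewrite (le_trans t0)// (le_trans _ tx)// t_nd.
have mU : measurable (\bigcup_n I n) by exact: bigcupT_measurable.
apply: (@le_trans _ _ (\int[lebesgue_measure]_(x in \bigcup_n I n) (g x)%:E)%E);
  last first.
  apply: ge0_subset_integral => //.
    exact: measurable_fun_EFin_nonincreasing.
  by move=> x _; rewrite lee_fin.
rewrite ge0_integral_bigcup//; last 3 first.
- exact: measurable_fun_EFin_nonincreasing.
- by move=> x _; rewrite lee_fin.
- exact: trivIset_itv_nondecreasing.
apply: le_trans (nneseries_lim_ge J _); last first.
  by move=> n _ _; apply: integral_ge0 => x _; rewrite lee_fin.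
rewrite big_mkord -sumEFin; apply: lee_sum => j _.
rewrite -integral_cst_itv; last exact: t_nd.
apply: ge0_le_integral => //.
- by move=> x _; rewrite lee_fin.
- exact: measurable_fun_EFin_nonincreasing.
- move=> x; rewrite /= in_itv/= => /andP[_ /ltW xt]; rewrite lee_fin.
  exact: g_ni.
Qed.

Lemma integral_le_sum g (a C : R) : 0 < a ->
  {homo g : x y /~ x <= y} -> (forall x, 0 <= g x) ->
  (forall N, \sum_(n < N) g (n%:R * a) * a <= C) ->
  (\int[lebesgue_measure]_(x in `[0%R, +oo[) (g x)%:E <= C%:E)%E.
Proof.
move=> a0 g_ni g0 gC; pose t n : R := n%:R * a.
have t_nd : nondecreasing_seq t by move=> m n mn; rewrite ler_wpM2r ?ler_nat// ltW.
have tS n : t n.+1 - t n = a by rewrite /t -natr1; ring.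
have -> : `[0, +oo[%classic = \bigcup_n `[t n, t n.+1[%classic.
  apply/seteqP; split => x /=.
    rewrite in_itv/= andbT => x0; exists (Num.truncn (x / a)) => //=.
    have /andP[l u] := truncn_itv (divr_ge0 x0 (ltW a0)).
    by rewrite in_itv/= /t -ler_pdivlMr// l -ltr_pdivrMr.
  move=> [n _]; rewrite /= !in_itv/= andbT => /andP[tx _].
  by rewrite (le_trans _ tx)// mulr_ge0// ltW.
rewrite ge0_integral_bigcup//; last 3 first.
- apply: measurable_fun_EFin_nonincreasing => //.
  by apply: bigcupT_measurable => n; exact: measurable_itv.
- by move=> x _; rewrite lee_fin.
- exact: trivIset_itv_nondecreasing.
apply: lime_le.
  by apply: is_cvg_nneseries => n _ _; apply: integral_ge0 => x _; rewrite lee_fin.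
near=> N; rewrite big_mkord; apply: le_trans (_ : _ <= (\sum_(n < N) g (n%:R * a) * a)%:E)%E _; last by rewrite lee_fin.
rewrite -sumEFin; apply: lee_sum => j _.
rewrite -[X in (_ * X)%:E](tS j) -integral_cst_itv; last exact: t_nd.
apply: ge0_le_integral => //.
- by move=> x _; rewrite lee_fin.
- exact: measurable_fun_EFin_nonincreasing.
- by move=> x; rewrite /= in_itv/= => /andP[tx _]; rewrite lee_fin; exact: g_ni.
Unshelve. all: by end_near. Qed.

End IntegralTest.

(** * Clipping and regular cutoffs *)

Section Gate.
Context {R : realType}.

(** A Lipschitz substitute for the indicator of [c <= |x|], squeezed for
    [0 < c] between the indicators of [c <= |x|] and [c / 2 <= |x|]: identical distribution,
    negative dependence and independence only concern such regular
    functions. *)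
Definition gate (c x : R) : R := Num.min (Num.max (2 / c * `|x| - 1) 0) 1.

Definition clip (c x : R) : R := Num.max (Num.min x c) (- c).

Lemma lipR_gate c : lipR (gate c).
Proof.
apply: lipR_min; apply: lipR_max; apply: (lipR_add _ (lipR_cst (-1))).
exact/lipR_scale/lipR_norm/lipR_id.
Qed.

Lemma lipR_clip c : lipR (clip c).
Proof. exact/lipR_max/lipR_min/lipR_id. Qed.

Lemma gate_ge0 c x : 0 <= gate c x.
Proof. by rewrite le_min ler01 le_max lexx orbT. Qed.

Lemma gate_le1 c x : gate c x <= 1.
Proof. by rewrite ge_min lexx orbT. Qed.

Lemma gate1 c x : 0 < c -> c <= `|x| -> gate c x = 1.
Proof.
move=> c0 cx; apply/min_idPr; rewrite le_max; apply/orP; left.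
by rewrite lerBrDr mulrAC ler_pdivlMr//; lra.
Qed.

Lemma gate0 c x : 0 < c -> `|x| <= c / 2 -> gate c x = 0.
Proof.
move=> c0 cx; rewrite /gate (max_idPr _) ?min_l//.
by rewrite lerBlDr add0r mulrAC ler_pdivrMr//; lra.
Qed.

Lemma norm_gate_le1 c x : `|gate c x| <= 1.
Proof. by rewrite ger0_norm ?gate_ge0 ?gate_le1. Qed.

Lemma clip_norm_le c x : 0 <= c -> `|clip c x| <= c.
Proof.
move=> c0; rewrite ler_norml; apply/andP; split.
  by rewrite le_max lexx orbT.
by rewrite ge_max ge_min lexx orbT/=; lra.
Qed.

Lemma clip_le_norm c x : 0 <= c -> `|clip c x| <= `|x|.
Proof.
move=> c0; rewrite /clip; case: (leP x c) => h1; rewrite /Num.max; case: ltP => h2;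
  case: (ger0P x) => h3; do ?[case: ger0P => ?]; lra.
Qed.

Lemma clip_id c x : `|x| <= c -> clip c x = x.
Proof. by rewrite ler_norml => /andP[h1 h2]; rewrite /clip min_l// max_l. Qed.

Lemma clip_nd c : {homo clip c : x y / x <= y}.
Proof.
by move=> x y xy; rewrite /clip ge_max !le_max lexx orbT andbT le_min !ge_min xy lexx orbT.
Qed.

(** Relates clipping to the excess over [c], the quantity in the uniform
    integrability condition. *)
Lemma dist_clip c x : 0 <= c -> `|x - clip c x| = Num.max (`|x| - c) 0.
Proof.
move=> c0; rewrite /clip; case: (leP x c) => h1; rewrite /Num.max;
  case: ltP => h2; case: ltP => h3; case: (ger0P x) h3 => h4 h3;
  case: ger0P; lra.
Qed.

End Gate.

(** * Maximal backward sums under negative dependence *)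

Section Lindley.
Context {R : realType}.
Implicit Types (f : R -> R) (x y : nat -> R).

(** Lindley's recursion: [lindley f x n] is the maximum over [m <= n] of
    [f (x m) + ... + f (x n.-1)].  Maximal backward sums are used because, in
    contrast to maximal partial sums, they form a nondecreasing function of the
    past to which one more term is added, which is the shape to which negative
    dependence applies. *)
Fixpoint lindley f x (n : nat) : R :=
  if n is k.+1 then Num.max (lindley f x k + f (x k)) 0 else 0.

Lemma lindley_ge0 f x n : 0 <= lindley f x n.
Proof. by case: n => [|n]//=; rewrite le_max lexx orbT. Qed.

Lemma lindley_le f x n (B : R) : (forall z, `|f z| <= B) ->
  lindley f x n <= n%:R * B.
Proof.
move=> fB; elim: n => [|n IH] /=; first by rewrite mul0r.
have B0 : 0 <= B by apply: le_trans (fB 0).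
have fxB : f (x n) <= B by apply: le_trans (fB (x n)); rewrite ler_norm.
by rewrite ge_max -natr1 mulrDl mul1r lerD//= addr_ge0// mulr_ge0.
Qed.

Lemma eq_lindley f x y n : (forall k, (k < n)%N -> x k = y k) ->
  lindley f x n = lindley f y n.
Proof.
elim: n => [//|n IH] xy /=; rewrite xy// IH// => k kn.
by apply: xy; rewrite (ltn_trans kn).
Qed.

Lemma lindley_dist f x y n (C : R) :
  (forall a b, `|f a - f b| <= C * `|a - b|) ->
  `|lindley f x n - lindley f y n| <= C * \sum_(k < n) `|x k - y k|.
Proof.
move=> fC; elim: n => [|n IH]; first by rewrite subrr normr0 big_ord0 mulr0.
rewrite big_ord_recr/= mulrDr; apply: le_trans (ler_dist_max _ _ _) _.
rewrite opprD addrACA; apply: le_trans (ler_normD _ _) _.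
exact: lerD.
Qed.

Lemma lindley_nd f x y n : {homo f : a b / a <= b} ->
  (forall k, (k < n)%N -> x k <= y k) -> lindley f x n <= lindley f y n.
Proof.
move=> f_nd; elim: n => [//|n IH] xy /=.
rewrite ge_max !le_max lexx orbT andbT; apply/orP; left; apply: lerD.
  by apply: IH => k kn; apply: xy; rewrite (ltn_trans kn).
exact/f_nd/xy.
Qed.

Lemma sum_le_lindley f x m n : (m <= n)%N ->
  \sum_(m <= k < n) f (x k) <= lindley f x n.
Proof.
elim: n => [|n IH]; first by rewrite leqn0 => /eqP ->; rewrite big_geq.
rewrite leq_eqVlt => /predU1P[->|mn]; first by rewrite big_geq// lindley_ge0.
by rewrite big_nat_recr//= le_max lerD2r IH.
Qed.

Lemma lindley_sqr_le f x n :
  lindley f x n.+1 ^+ 2 <=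
  lindley f x n ^+ 2 + 2 * (lindley f x n * f (x n)) + f (x n) ^+ 2.
Proof.
set a := lindley f x n; set b := f (x n); rewrite [lindley _ _ _]/= -/a -/b.
have -> : a ^+ 2 + 2 * (a * b) + b ^+ 2 = (a + b) ^+ 2 by ring.
by rewrite /Num.max; case: ltP => _//; rewrite expr0n sqr_ge0.
Qed.

End Lindley.

Section NegativeDependence.
Context {R : realType} {d : measure_display} {T : measurableType d}.
Context {H : set (T -> R)} {E : (T -> R) -> \bar R}.
Context (hE : sublinear_expectation_space H E).
Context {X : nat -> T -> R} (hX : forall n, H (X n)).

Implicit Types f : R -> R.

Local Notation mean := (@mean R d T E).
Local Notation L1 := (@rv_L1 R d T H E).

Lemma rv_lindley f n : lipR f -> H (fun w => lindley f (X^~ w) n).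
Proof.
move=> lf; elim: n => [|n IH] /=; first exact: rv_cst hE 0.
have HS := rv_add (sles_rv hE) IH (rv_lipR hE (hX n) lf).
exact: (rv_lipR hE HS (lipR_max 0 lipR_id)).
Qed.

Lemma rv_L1_lipR f B i : lipR f -> (forall z, `|f z| <= B) ->
  L1 (fun w => f (X i w)).
Proof.
by move=> lf fB; apply: (rv_L1_bounded hE (M := B)) => //; exact: (rv_lipR hE).
Qed.

Lemma identically_distributed_mean f B i : identically_distributed E X ->
  lipR f -> (forall z, `|f z| <= B) ->
  mean (fun w => f (X i w)) = mean (fun w => f (X 0%N w)).
Proof.
move=> hid lf fB.
have eqf j : (fun w => f (rvec (fun=> X j) w ord0 ord0)) = (fun w => f (X j w)).
  by apply/funext => w; rewrite mxE.
have := hid i _ (cl_lip1 lf); rewrite /= !eqf => h.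
by rewrite /mean h//; apply: (E_fin hE); exact: rv_L1_lipR fB.
Qed.

(** The past enters through the nonnegative nondecreasing [lindley], and the last
    factor is centred, so negative dependence bounds the mean of the product by
    a multiple of 0. *)
Lemma neg_dependent_mean_le0 f B i : neg_dependent_seq E X ->
  lipR f -> (forall z, `|f z| <= B) -> {homo f : a b / a <= b} ->
  mean (fun w => f (X i w)) = 0 ->
  mean (fun w => lindley f (X^~ w) i * f (X i w)) <= 0.
Proof.
move=> hnd lf fB f_nd f0; case: i f0 => [|i] f0 /=.
  by under eq_fun do rewrite mul0r; rewrite (mean_cst hE).
have B0 : 0 <= B by apply: le_trans (fB 0).
have [C fC] := lf.
pose phi1 (v : 'rV[R]_i.+1) := lindley f (fun k => v ord0 (inord k)) i.+1.
have phi1E w : phi1 (rvec (fun j : 'I_i.+1 => X j) w) = lindley f (X^~ w) i.+1.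
  by apply: eq_lindley => k ki; rewrite mxE inordK.
have lphi1 : cl_lip phi1.
  apply: (@cl_lip_coord _ _ _ C) => x y; apply: le_trans (lindley_dist _ _ _ fC) _.
  by under eq_bigr do rewrite inord_val.
pose phi2 (v : 'rV[R]_1) := f (v ord0 ord0).
have phi2E w : phi2 (rvec (fun _ : 'I_1 => X i.+1) w) = f (X i.+1 w).
  by rewrite /phi2 mxE.
have LL : L1 (fun w => lindley f (X^~ w) i.+1).
  apply: (rv_L1_bounded hE (M := i.+1%:R * B)); first exact: rv_lindley.
  by move=> w; rewrite ger0_norm ?lindley_ge0// lindley_le.
have LZ : L1 (fun w => f (X i.+1 w)) by exact: rv_L1_lipR fB.
have LLZ : L1 (fun w => lindley f (X^~ w) i.+1 * f (X i.+1 w)).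
  apply: (rv_L1_bounded hE (M := i.+1%:R * B * B)).
    by apply: (rv_mul hE); [exact: rv_L1_H LL|exact: rv_L1_H LZ].
  by move=> w; rewrite normrM ler_pM// ger0_norm ?lindley_ge0// lindley_le.
have : (E (fun w => phi1 (rvec (fun j : 'I_i.+1 => X j) w) *
    phi2 (rvec (fun _ : 'I_1 => X i.+1) w))%R <=
    E (fun w => phi1 (rvec (fun j : 'I_i.+1 => X j) w)) *
    E (fun w => phi2 (rvec (fun _ : 'I_1 => X i.+1) w)))%E.
  apply: hnd => //; first exact: cl_lip1.
  - by move=> w; rewrite phi1E lindley_ge0.
  - by under eq_fun do rewrite phi2E; rewrite (meanE hE LZ) f0.
  - by under eq_fun do rewrite phi1E phi2E; case: LLZ.
  - by under eq_fun do rewrite phi1E; case: LL.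
  - by under eq_fun do rewrite phi2E; case: LZ.
  - left; split => x y xy; last exact/f_nd/xy.
    by apply: lindley_nd => // k ki; exact: xy.
under eq_fun do rewrite phi1E phi2E.
under [X in (_ <= _ * E X)%E]eq_fun do rewrite phi2E.
by rewrite (meanE hE LZ) f0 mule0 (meanE hE LLZ) lee_fin.
Qed.

(** The cross term of each step of Lindley's recursion has nonpositive mean, so
    the second moment grows at most as for uncorrelated summands. *)
Lemma mean_lindley_sqr_le f B (s : R) n : neg_dependent_seq E X ->
  lipR f -> (forall z, `|f z| <= B) -> {homo f : a b / a <= b} ->
  (forall i, mean (fun w => f (X i w)) = 0) ->
  (forall i, mean (fun w => f (X i w) ^+ 2) <= s) ->
  mean (fun w => lindley f (X^~ w) n ^+ 2) <= n%:R * s.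
Proof.
move=> hnd lf fB f_nd f0 fs.
have LZ i : L1 (fun w => f (X i w)) by exact: rv_L1_lipR fB.
have LZ2 i : L1 (fun w => f (X i w) ^+ 2).
  apply: (rv_L1_bounded hE (M := B ^+ 2)); first exact/(rv_sqr hE)/rv_L1_H/LZ.
  by move=> w; rewrite normrX lerXn2r// nnegrE// (le_trans _ (fB 0)).
have Llin k w : `|lindley f (X^~ w) k| <= k%:R * B.
  by rewrite ger0_norm ?lindley_ge0// lindley_le.
have LL2 k : L1 (fun w => lindley f (X^~ w) k ^+ 2).
  apply: (rv_L1_bounded hE (M := (k%:R * B) ^+ 2)).
    exact/(rv_sqr hE)/rv_lindley.
  by move=> w; rewrite normrX lerXn2r// nnegrE// (le_trans _ (Llin k w)).
have LLZ k : L1 (fun w => lindley f (X^~ w) k * f (X k w)).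
  apply: (rv_L1_bounded hE (M := k%:R * B * B)).
    by apply: (rv_mul hE); [exact: rv_lindley|exact: rv_L1_H (LZ k)].
  by move=> w; rewrite normrM ler_pM.
elim: n => [|n IH].
  by rewrite mul0r; under eq_fun do rewrite expr0n; rewrite (mean_cst hE).
have L2 := rv_L1_scale hE 2 (LLZ n).
apply: (@le_trans _ _ (mean (fun w => lindley f (X^~ w) n ^+ 2 +
    2 * (lindley f (X^~ w) n * f (X n w)) + f (X n w) ^+ 2))).
  apply: (mean_le hE) => [//||w]; last exact: lindley_sqr_le.
  exact/(rv_L1_add hE)/LZ2/(rv_L1_add hE).
apply: le_trans (mean_add hE (rv_L1_add hE (LL2 n) L2) (LZ2 n)) _.
have := mean_add hE (LL2 n) L2; rewrite (mean_scale hE)//.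
have := neg_dependent_mean_le0 hnd lf fB f_nd (f0 n).
have cross := neg_dependent_mean_le0 hnd lf fB f_nd (f0 n).
have sn := fs n; rewrite -natr1 mulrDl mul1r => step.
lra.
Qed.

End NegativeDependence.

(** * The Choquet integral and sums of tails *)

Section TailSums.
Context {R : realType} {d : measure_display} {T : measurableType d}.
Context {H : set (T -> R)} {E : (T -> R) -> \bar R}.
Context (hE : sublinear_expectation_space H E).
Implicit Types Y : T -> R.

Local Notation mean := (@mean R d T E).
Local Notation L1 := (@rv_L1 R d T H E).
Local Notation V := (capacity H E).

(** The negative half line does not contribute, since there the event has
    capacity 1. *)
Lemma choquet_ge0E Y : (forall w, 0 <= Y w) ->
  choquet V Y = (\int[lebesgue_measure]_(t in `[0%R, +oo[)
    (fine (V [set w | t <= Y w]%R))%:E)%E.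
Proof.
move=> Y0; rewrite /choquet [X in (_ + X)%E]integral0_eq ?adde0.
  by apply: eq_integral => t _; rewrite fineK// (capacity_fin hE).
move=> t; rewrite /= in_itv/= => t0.
rewrite [X in V X](_ : _ = setT) ?(capacity_setT hE) ?subee//.
by apply/seteqP; split => // w _; exact: le_trans t0 (Y0 w).
Qed.

Lemma tail_capacity_nonincreasing Y :
  {homo (fun t => fine (V [set w | t <= Y w]%R)) : x y /~ x <= y}.
Proof.
move=> x y xy; apply: fine_le; [exact: (capacity_fin hE)..|].
by apply: le_capacity => w; exact: le_trans.
Qed.

Lemma tail_capacity_ge0 Y t : 0 <= fine (V [set w | t <= Y w]%R).
Proof. exact/fine_ge0/(capacity_ge0 hE). Qed.

Lemma rv_L1_gate c Y : H Y -> L1 (fun w => gate c (Y w)).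
Proof.
move=> HY; apply: (rv_L1_bounded hE (M := 1)) => [|w].
  exact: (rv_lipR hE HY (lipR_gate c)).
exact: norm_gate_le1.
Qed.

Lemma mean_gate_le_capacity c Y : 0 < c -> H Y ->
  mean (fun w => gate c (Y w)) <= fine (V [set w | c / 2 <= `|Y w|]).
Proof.
move=> c0 HY; rewrite -lee_fin -(meanE hE (rv_L1_gate c HY)) fineK ?(capacity_fin hE)//.
apply: (le_capacity_E hE); first exact: rv_L1_H (rv_L1_gate c HY).
move=> w; rewrite indicE; case: (boolP (_ \in _)) => [_|]; first exact: gate_le1.
by rewrite notin_setE/= => /negP; rewrite -ltNge => /ltW /(gate0 c0) ->.
Qed.

Lemma capacity_le_mean_gate c Y : 0 < c -> H Y ->
  fine (V [set w | c <= `|Y w|]) <= mean (fun w => gate c (Y w)).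
Proof.
move=> c0 HY; rewrite -lee_fin -(meanE hE (rv_L1_gate c HY)) fineK ?(capacity_fin hE)//.
apply: capacity_le => [|w]; first exact: rv_L1_H (rv_L1_gate c HY).
rewrite indicE; case: (boolP (_ \in _)) => [|_]; last exact: gate_ge0.
by rewrite inE/= => /(gate1 c0) ->.
Qed.

(** The tail capacity is nonincreasing, so its integral from [q 2^j / 4] to
    [q 2^j / 2] is at least a quarter of the [j]-th term. *)
Lemma sum_mean_gate_bounded Y (q : R) : H Y -> 0 < q ->
  (choquet V (fun w => `|Y w|)%R < +oo)%E ->
  exists C, forall J,
    \sum_(j < J) q * 2 ^+ j * mean (fun w => gate (q * 2 ^+ j) (Y w)) <= C.
Proof.
move=> HY q0; rewrite choquet_ge0E//; set I := integral _ _ _ => Ioo.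
exists (4 * fine I) => J; pose t j : R := q * 2 ^+ j / 4.
have q2 j : 0 < q * 2 ^+ j by rewrite mulr_gt0// exprn_gt0.
have t_nd : nondecreasing_seq t.
  by apply/nondecreasing_seqP => n; rewrite /t exprS; have := q2 n; lra.
have t0 : 0 <= t 0%N by rewrite /t divr_ge0// ltW.
have := integral_ge_sum J (@tail_capacity_nonincreasing (fun w => `|Y w|))
  (tail_capacity_ge0 _) t_nd t0.
rewrite -/I -[I in (_ <= I)%E]fineK; last first.
  by rewrite ge0_fin_numE// integral_ge0// => x _; rewrite lee_fin tail_capacity_ge0.
rewrite lee_fin => h; apply: le_trans (ler_wpM2l _ h) => //.
rewrite mulr_sumr; apply: ler_sum => j _.
have -> : t j.+1 = q * 2 ^+ j / 2 by rewrite /t exprS; field.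
have -> : q * 2 ^+ j / 2 - t j = q * 2 ^+ j / 4 by rewrite /t; field.
have := mean_gate_le_capacity (q2 j) HY.
move: (mean _) (fine _) (q2 j) => a b; set c := q * _ => c0 ab.
have -> : 4 * (b * (c / 4)) = c * b by field.
by rewrite ler_wpM2l// ltW.
Qed.

Lemma choquet_lt_pinfty Y (a C : R) : H Y -> 0 < a ->
  (forall N, \sum_(n < N) mean (fun w => gate (n.+1%:R * a) (Y w)) <= C) ->
  (choquet V (fun w => `|Y w|)%R < +oo)%E.
Proof.
move=> HY a0 YC; rewrite choquet_ge0E//.
apply: (@le_lt_trans _ _ ((1 + C) * a)%:E); last exact: ltry.
apply: (integral_le_sum a0 (@tail_capacity_nonincreasing _) (tail_capacity_ge0 _)).
move=> N; rewrite -mulr_suml ler_pM2r//.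
have C0 : 0 <= C by have := YC 0%N; rewrite big_ord0.
case: N => [|N]; first by rewrite big_ord0 addr_ge0.
rewrite big_ord_recl lerD//.
  by rewrite -lee_fin fineK ?(capacity_fin hE)// (capacity_le1 hE).
apply: le_trans (YC N); apply: ler_sum => n _.
by apply: capacity_le_mean_gate => //; rewrite mulr_gt0.
Qed.

Lemma rv_L1_clip c Y : 0 <= c -> H Y -> L1 (fun w => clip c (Y w)).
Proof.
move=> c0 HY; apply: (rv_L1_bounded hE (M := c)) => [|w].
  exact: (rv_lipR hE HY (lipR_clip c)).
exact: clip_norm_le.
Qed.

Lemma clip_sqr_le c (x : R) : 0 <= c -> clip c x ^+ 2 <= c ^+ 2.
Proof.
move=> c0; rewrite -[leLHS]ger0_norm ?sqr_ge0// normrX.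
by rewrite lerXn2r ?nnegrE// clip_norm_le.
Qed.

Lemma rv_L1_clip_sqr c Y : 0 <= c -> H Y -> L1 (fun w => clip c (Y w) ^+ 2).
Proof.
move=> c0 HY; apply: (rv_L1_bounded hE (M := c ^+ 2)) => [|w].
  exact/(rv_sqr hE)/rv_L1_H/rv_L1_clip.
by rewrite ger0_norm ?sqr_ge0// clip_sqr_le.
Qed.

(** Doubling the clipping level changes the square only on [c <= |Y|], where it
    is at most [(2 * c) ^ 2]. *)
Lemma mean_clip_sqr_double c Y : 0 < c -> H Y ->
  mean (fun w => clip (2 * c) (Y w) ^+ 2) <=
  mean (fun w => clip c (Y w) ^+ 2) + 4 * c ^+ 2 * mean (fun w => gate c (Y w)).
Proof.
move=> c0 HY; have c20 : 0 <= 2 * c by lra.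
have k0 : 0 <= 4 * c ^+ 2 by rewrite mulr_ge0// sqr_ge0.
have LG := rv_L1_gate c HY; have LC := rv_L1_clip_sqr (ltW c0) HY.
rewrite -(mean_scale hE k0 LG).
apply: le_trans (mean_add hE LC (rv_L1_scale hE _ LG)).
apply: (mean_le hE) => [||w]; first exact: rv_L1_clip_sqr.
  exact/(rv_L1_add hE LC)/(rv_L1_scale hE).
have [Yc|/ltW Yc] := leP `|Y w| c.
  rewrite !clip_id//; last by lra.
  by rewrite lerDl mulr_ge0// gate_ge0.
rewrite (gate1 c0 Yc) mulr1 (le_trans (clip_sqr_le _ c20))//.
by rewrite exprMn -natrX lerDr sqr_ge0.
Qed.

(** With [b j := mean (clip (q 2^j) Y)^2 / (q 2^j)] the previous bound reads
    [b j.+1 <= b j / 2 + 2 q 2^j mean (gate (q 2^j) Y)], so the partial sums of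
    [b] are controlled by those of the tails. *)
Lemma sum_mean_clip_sqr_bounded Y (q : R) : H Y -> 0 < q ->
  (choquet V (fun w => `|Y w|)%R < +oo)%E ->
  exists C, forall J,
    \sum_(j < J) mean (fun w => clip (q * 2 ^+ j) (Y w) ^+ 2) / (q * 2 ^+ j) <= C.
Proof.
move=> HY q0 /(sum_mean_gate_bounded HY q0)[C YC].
pose b j := mean (fun w => clip (q * 2 ^+ j) (Y w) ^+ 2) / (q * 2 ^+ j).
have q2 j : 0 < q * 2 ^+ j by rewrite mulr_gt0// exprn_gt0.
have b0 j : 0 <= b j.
  rewrite divr_ge0 ?(ltW (q2 j))//; apply: (mean_ge0 hE) => [|w].
    by apply: rv_L1_clip_sqr => //; exact: ltW.
  exact: sqr_ge0.
have bS j : b j.+1 <= b j / 2 +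
    2 * (q * 2 ^+ j * mean (fun w => gate (q * 2 ^+ j) (Y w))).
  have := mean_clip_sqr_double (q2 j) HY.
  rewrite /b (_ : q * 2 ^+ j.+1 = 2 * (q * 2 ^+ j)); last by rewrite exprS; ring.
  have aux (c x y z : R) : 0 < c -> x <= y + 4 * c ^+ 2 * z ->
      x / (2 * c) <= y / c / 2 + 2 * (c * z).
    move=> c0 h; rewrite ler_pdivrMr; last by lra.
    apply: le_trans h _; rewrite le_eqVlt; apply/orP; left; apply/eqP.
    by field; lra.
  exact: aux (q2 j).
exists (2 * b 0%N + 4 * C) => J; rewrite -/(\sum_(j < J) b j).
have C0 : 0 <= C by have := YC 0%N; rewrite big_ord0.
case: J => [|J].
  by rewrite big_ord0 addr_ge0// mulr_ge0.
have step K : \sum_(j < K.+1) b j <= b 0%N + (\sum_(j < K) b j) / 2 +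
    2 * \sum_(j < K) q * 2 ^+ j * mean (fun w => gate (q * 2 ^+ j) (Y w)).
  rewrite big_ord_recl -addrA lerD2l mulr_suml mulr_sumr -big_split/=.
  by apply: ler_sum => j _; exact: bS.
have := step J; have := YC J; have := b0 J; rewrite big_ord_recr/= => h1 h2 h3.
lra.
Qed.

End TailSums.

(** * Deviations along dyadic indices *)

Lemma sum_inv_pow2_le (R : realType) J :
  \sum_(j < J) (2 ^+ j)^-1 <= 2 :> R.
Proof.
have : \sum_(j < J) (2 ^+ j)^-1 = 2 - 2 / 2 ^+ J :> R.
  elim: J => [|J IH]; first by rewrite big_ord0 expr0; field.
  have := exprn_gt0 J (ltr0n R 2); rewrite big_ord_recr/= IH exprS => h.
  by field; lra.
by move=> ->; rewrite gerBl divr_ge0// exprn_ge0.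
Qed.

Section Deviation.
Context {R : realType} {d : measure_display} {T : measurableType d}.
Context {H : set (T -> R)} {E : (T -> R) -> \bar R}.
Context (hE : sublinear_expectation_space H E).
Context {X : nat -> T -> R} (hX : forall n, H (X n)).

Local Notation mean := (@mean R d T E).
Local Notation L1 := (@rv_L1 R d T H E).
Local Notation V := (capacity H E).

Definition clipped_mean (n : nat) : R := mean (fun w => clip n%:R (X 0%N w)).

Definition centred_clip n (z : R) := clip n%:R z - clipped_mean n.

(** This random variable dominates the indicator of the event that some
    backward partial sum [X m + ... + X n.-1] exceeds its mean by [eps * n]:
    the first sum detects that one of the first [n] variables reaches the
    clipping level [n], the second term is Chebyshev's bound for the clipped ones. *)
Definition deviation (eps : R) (n : nat) (w : T) : R :=
  \sum_(k < n) gate n%:R (X k w) +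
  ((eps * n%:R) ^+ 2)^-1 * lindley (centred_clip n) (X^~ w) n ^+ 2.

Lemma lipR_centred_clip n : lipR (centred_clip n).
Proof. exact: lipR_add (lipR_clip _) (lipR_cst _). Qed.

Lemma centred_clip_le n z : `|centred_clip n z| <= n%:R + `|clipped_mean n|.
Proof. by rewrite (le_trans (ler_normB _ _))// lerD2r clip_norm_le. Qed.

Lemma centred_clip_nd n : {homo centred_clip n : x y / x <= y}.
Proof. by move=> x y xy; rewrite lerD2r clip_nd. Qed.

Lemma deviation_ge0 eps n w : 0 <= deviation eps n w.
Proof.
apply: addr_ge0; first by apply: sumr_ge0 => k _; exact: gate_ge0.
by rewrite mulr_ge0 ?invr_ge0 ?sqr_ge0.
Qed.

(** When the deviation is below 1 none of the first [n] variables is clipped, so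
    the backward sums are those of the clipped variables, which [lindley]
    dominates. *)
Lemma backward_sum_le eps n w m : 0 < eps -> (0 < n)%N -> (m <= n)%N ->
  deviation eps n w < 1 ->
  \sum_(m <= k < n) X k w <= (n - m)%:R * clipped_mean n + eps * n%:R.
Proof.
move=> eps0 n0 mn dev1; have n0' : 0 < n%:R :> R by rewrite ltr0n.
have c0 : 0 < eps * n%:R by rewrite mulr_gt0.
set S := lindley (centred_clip n) (X^~ w) n.
have S0 : 0 <= S by exact: lindley_ge0.
have gates0 : 0 <= \sum_(k < n) gate n%:R (X k w).
  by rewrite sumr_ge0// => k _; exact: gate_ge0.
have S2 : 0 <= ((eps * n%:R) ^+ 2)^-1 * S ^+ 2.
  by rewrite mulr_ge0 ?invr_ge0 ?sqr_ge0.
have Xn k : (k < n)%N -> `|X k w| <= n%:R.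
  move=> kn; rewrite leNgt; apply/negP => /ltW Xkn.
  suff : 1 <= deviation eps n w by rewrite leNgt dev1.
  rewrite /deviation -[leLHS]addr0 lerD// (bigD1 (Ordinal kn))//= gate1// lerDl sumr_ge0// => i _.
  exact: gate_ge0.
have Sle : S <= eps * n%:R.
  rewrite leNgt; apply/negP => Sgt.
  suff : 1 <= deviation eps n w by rewrite leNgt dev1.
  rewrite /deviation -[leLHS]add0r lerD// mulrC ler_pdivlMr ?exprn_gt0// mul1r.
  by rewrite lerXn2r ?nnegrE// ltW.
have := sum_le_lindley (centred_clip n) (X^~ w) mn; rewrite -/S => Sm.
have eq_sum : \sum_(m <= k < n) centred_clip n (X k w) =
    \sum_(m <= k < n) X k w - (n - m)%:R * clipped_mean n.
  rewrite mulr_natl -sumr_const_nat -sumrB; apply: eq_big_nat => k /andP[_ kn].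
  by rewrite /centred_clip clip_id//; exact: Xn.
by move: Sm; rewrite eq_sum => Sm; lra.
Qed.

Context (hid : identically_distributed E X) (hnd : neg_dependent_seq E X).
Context (L1X : L1 (X 0%N)).

Lemma abs_clipped_mean_le n : `|clipped_mean n| <= mean (fun w => `|X 0%N w|).
Proof.
have LC : L1 (fun w => clip n%:R (X 0%N w)) by exact: (rv_L1_clip hE).
apply: le_trans (abs_mean_le hE LC) _.
apply: (mean_le hE) => [||w]; [exact: (rv_L1_norm hE)..|].
exact: clip_le_norm.
Qed.

Lemma rv_L1_lindley_sqr n : L1 (fun w => lindley (centred_clip n) (X^~ w) n ^+ 2).
Proof.
pose B := n%:R * (n%:R + `|clipped_mean n|).
apply: (rv_L1_bounded hE (M := B ^+ 2)).
  exact/(rv_sqr hE)/(rv_lindley hE hX)/lipR_centred_clip.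
move=> w; rewrite normrX lerXn2r ?nnegrE//; first by rewrite mulr_ge0 ?addr_ge0.
by rewrite ger0_norm ?lindley_ge0// lindley_le//; exact: centred_clip_le.
Qed.

Lemma rv_L1_deviation eps n : L1 (deviation eps n).
Proof.
apply: (rv_L1_add hE); last exact/(rv_L1_scale hE)/rv_L1_lindley_sqr.
exact: (rv_L1_sum hE n (fun k => rv_L1_gate hE n%:R (hX k))).
Qed.

Lemma mean_centred_clip0 n i : mean (fun w => centred_clip n (X i w)) = 0.
Proof.
rewrite (identically_distributed_mean hE hX i hid (lipR_centred_clip n)
  (centred_clip_le n)).
by rewrite (mean_addc hE) ?subrr//; exact: (rv_L1_clip hE).
Qed.

Lemma mean_centred_clip_sqr n i : mean (fun w => centred_clip n (X i w) ^+ 2) <=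
  2 * mean (fun w => clip n%:R (X 0%N w) ^+ 2) +
  2 * mean (fun w => `|X 0%N w|) ^+ 2.
Proof.
have lf2 := lipR_sqr (centred_clip_le n) (lipR_centred_clip n).
have f2B z : `|centred_clip n z ^+ 2| <= (n%:R + `|clipped_mean n|) ^+ 2.
  by rewrite normrX lerXn2r ?nnegrE ?addr_ge0// centred_clip_le.
rewrite (identically_distributed_mean hE hX i hid lf2 f2B).
have L2 := rv_L1_clip_sqr hE (ler0n R n) (hX 0).
have Lf2 : L1 (fun w => centred_clip n (X 0%N w) ^+ 2).
  exact: (rv_L1_lipR hE hX 0 lf2 f2B).
apply: (@le_trans _ _ (mean (fun w => 2 * clip n%:R (X 0%N w) ^+ 2 +
    2 * clipped_mean n ^+ 2))).
  apply: (mean_le hE) => // [|w].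
    exact: (rv_L1_add hE (rv_L1_scale hE _ L2) (rv_L1_cst hE _)).
  rewrite /centred_clip; move: (clip _ _) (clipped_mean n) => a b.
  by have := sqr_ge0 (a + b); lra.
rewrite (mean_addc hE) ?(mean_scale hE)//; last exact: (rv_L1_scale hE).
rewrite lerD2l ler_pM2l// -[leLHS]ger0_norm ?sqr_ge0// normrX lerXn2r ?nnegrE//.
  by apply: (mean_ge0 hE) => [|w]//; exact: (rv_L1_norm hE).
exact: abs_clipped_mean_le.
Qed.

Lemma mean_deviation_le eps n : 0 < eps -> (0 < n)%N ->
  mean (deviation eps n) <=
  n%:R * mean (fun w => gate n%:R (X 0%N w)) +
  2 / eps ^+ 2 * (mean (fun w => clip n%:R (X 0%N w) ^+ 2) / n%:R) +
  2 * mean (fun w => `|X 0%N w|) ^+ 2 / eps ^+ 2 * n%:R^-1.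
Proof.
move=> eps0 n0; have n0' : 0 < n%:R :> R by rewrite ltr0n.
have LG k : L1 (fun w => gate n%:R (X k w)).
  exact: (rv_L1_gate hE).
apply: le_trans (mean_add hE (rv_L1_sum hE _ LG)
  (rv_L1_scale hE _ (rv_L1_lindley_sqr n))) _.
rewrite (mean_scale hE); last 2 first.
- by rewrite invr_ge0 sqr_ge0.
- exact: rv_L1_lindley_sqr.
rewrite -addrA; apply: lerD.
  apply: le_trans (mean_sum hE _ LG) _.
  rewrite [leLHS](eq_bigr (fun=> mean (fun w => gate n%:R (X 0%N w)))).
    by rewrite sumr_const card_ord mulr_natl.
  move=> k _; apply: (identically_distributed_mean hE hX k hid (lipR_gate _)).
  exact: norm_gate_le1.
have := mean_lindley_sqr_le hE hX n hnd (lipR_centred_clip n)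
  (centred_clip_le n) (@centred_clip_nd n) (mean_centred_clip0 n)
  (mean_centred_clip_sqr n).
move: (mean _) => a; move: (mean _) (mean _) => b c h.
rewrite mulrC ler_pdivrMr ?exprn_gt0 ?mulr_gt0//; apply: le_trans h _.
by rewrite le_eqVlt; apply/orP; left; apply/eqP; field; lra.
Qed.

Lemma deviation_null (q : nat) eps : (0 < q)%N -> 0 < eps ->
  (choquet V (fun w => `|X 0%N w|)%R < +oo)%E ->
  outer_capacity H E [set w | forall N, exists2 j, (N <= j)%N &
    1 <= deviation eps (q * 2 ^ j)%N w] = 0%E.
Proof.
move=> q0 eps0 Xoo; have q0' : 0 < q%:R :> R by rewrite ltr0n.
have [A XA] := sum_mean_gate_bounded hE (hX 0) q0' Xoo.
have [B XB] := sum_mean_clip_sqr_bounded hE (hX 0) q0' Xoo.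
set M := 2 * mean (fun w => `|X 0%N w|) ^+ 2 / eps ^+ 2.
have M0 : 0 <= M by rewrite divr_ge0 ?sqr_ge0// mulr_ge0 ?sqr_ge0.
apply: (borel_cantelli hE (C := A + 2 / eps ^+ 2 * B + M * (q%:R^-1 * 2))).
- by move=> j; exact: rv_L1_deviation.
- by move=> j w; exact: deviation_ge0.
have n0 j : (0 < q * 2 ^ j)%N by rewrite muln_gt0 q0 expn_gt0.
move=> J; apply: le_trans.
  by apply: ler_sum => j _; exact: (mean_deviation_le eps0 (n0 j)).
under eq_bigr do rewrite natrM natrX.
rewrite !big_split/= -!mulr_sumr.
under [X in _ + _ * X]eq_bigr do rewrite invfM.
rewrite -mulr_sumr; apply: lerD.
  apply: lerD; first exact: XA.
  by apply: ler_wpM2l; [rewrite divr_ge0 ?sqr_ge0|exact: XB].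
apply: (ler_wpM2l M0); apply: ler_wpM2l (sum_inv_pow2_le R J).
by rewrite invr_ge0 ltW.
Qed.

End Deviation.

(** * From dyadic indices to all indices *)

(** The numbers [q * 2 ^ j] with [q <= 2 * L] approximate every large integer
    from above up to a factor [1 + 1 / L]: finitely many geometric sequences
    replace one of ratio close to 1. *)
Lemma dyadic_approx (L J m : nat) : (0 < L)%N -> (L * 2 ^ J <= m)%N ->
  exists j q, [/\ (J <= j)%N, (0 < q <= 2 * L)%N, (m <= q * 2 ^ j)%N &
    ((q * 2 ^ j - m) * L <= m)%N].
Proof.
move=> L0 Lm; have Jm : (2 ^ J <= m %/ L)%N by rewrite leq_divRL// mulnC.
have mL0 : (0 < m %/ L)%N by rewrite (leq_trans _ Jm)// expn_gt0.
have /andP[jl ju] := trunc_log_bounds (isT : (1 < 2)%N) mL0.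
set j := trunc_log 2 (m %/ L) in jl ju *.
have j0 : (0 < 2 ^ j)%N by rewrite expn_gt0.
exists j, (m %/ 2 ^ j).+1; split.
- exact: trunc_log_max.
- by rewrite /= ltn_divLR// mulnAC -expnS -ltn_divLR.
- exact/ltnW/ltn_ceil.
- apply: (@leq_trans (2 ^ j * L)); last by rewrite -leq_divRL.
  rewrite leq_mul2r mulSn leq_subLR addnC leq_add2r leq_divM orbT//.
Qed.

(** Transfer to all indices. With [n = q * 2 ^ j] slightly above [m], the sum up
    to [m] is the sum up to [n] plus the sum of the opposite terms from [m] to
    [n]; the hypotheses bound the former by [n * mu n] and the latter by
    [(n - m) * M], up to [n / (p + 1)]. *)
Lemma partial_sum_le (R : realType) (x mu nu : nat -> R) (a M : R) :
  (forall n, `|mu n| <= M) -> (forall n, `|nu n| <= M) ->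
  (forall e, 0 < e -> exists N, forall n, (N <= n)%N -> mu n <= a + e) ->
  (forall q p, (0 < q)%N -> exists N, forall j, (N <= j)%N ->
     \sum_(0 <= k < q * 2 ^ j) x k <=
     (q * 2 ^ j)%:R * mu (q * 2 ^ j)%N + p.+1%:R^-1 * (q * 2 ^ j)%:R) ->
  (forall q p, (0 < q)%N -> exists N, forall j, (N <= j)%N ->
     forall m, (m <= q * 2 ^ j)%N ->
     \sum_(m <= k < q * 2 ^ j) - x k <=
     (q * 2 ^ j - m)%:R * nu (q * 2 ^ j)%N + p.+1%:R^-1 * (q * 2 ^ j)%:R) ->
  forall e, 0 < e -> exists N, forall m, (N <= m)%N ->
    \sum_(0 <= k < m) x k <= m%:R * (a + e).
Proof.
move=> muM nuM mua fwd bwd e' e'0.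
(* The error terms collected below amount to seven times [e * m]. *)
have [e e0 ->] : exists2 e, 0 < e & e' = 7 * e.
  by exists (e' / 7); [rewrite divr_gt0|field].
have M0 : 0 <= M by apply: le_trans (muM 0%N).
have [N muN] := mua e e0.
pose p := Num.truncn e^-1.
have pe : p.+1%:R^-1 <= e.
  rewrite -[leRHS]invrK lef_pV2 ?posrE ?invr_gt0//.
  by apply/ltW/truncnS_gt.
pose L := (Num.truncn (M / e)).+1.
have LM : M <= L%:R * e.
  by rewrite -ler_pdivrMr//; apply/ltW/truncnS_gt.
have [F fwdF] : {F : nat -> nat & forall q, (0 < q)%N -> forall j, (F q <= j)%N ->
    \sum_(0 <= k < q * 2 ^ j) x k <=
    (q * 2 ^ j)%:R * mu (q * 2 ^ j)%N + p.+1%:R^-1 * (q * 2 ^ j)%:R}.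
  apply: (@choice _ _ (fun q K => (0 < q)%N -> forall j, (K <= j)%N -> _ <= _)) => q.
  by case: q => [|q]; [exists 0%N|have [K] := fwd q.+1 p isT; exists K].
have [G bwdG] : {G : nat -> nat & forall q, (0 < q)%N -> forall j, (G q <= j)%N ->
    forall m, (m <= q * 2 ^ j)%N ->
    \sum_(m <= k < q * 2 ^ j) - x k <=
    (q * 2 ^ j - m)%:R * nu (q * 2 ^ j)%N + p.+1%:R^-1 * (q * 2 ^ j)%:R}.
  apply: (@choice _ _ (fun q K => (0 < q)%N -> forall j, (K <= j)%N ->
     forall m, _ -> _ <= _)) => q.
  by case: q => [|q]; [exists 0%N|have [K] := bwd q.+1 p isT; exists K].
pose J := \max_(q < (2 * L).+1) maxn (F q) (G q).
exists (maxn N (L * 2 ^ J)) => m; rewrite geq_max => /andP[Nm Lm].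
have [j [q [Jj /andP[q0 qL] mn nm]]] := dyadic_approx (isT : (0 < L)%N) Lm.
have FGJ : (maxn (F q) (G q) <= J)%N.
  exact: (@leq_bigmax _ (fun q : 'I__ => maxn (F q) (G q)) (Ordinal (qL : (q < _.+1)%N))).
have {fwdF} := fwdF q q0 j (leq_trans (leq_trans (leq_maxl _ _) FGJ) Jj).
have {bwdG} := bwdG q q0 j (leq_trans (leq_trans (leq_maxr _ _) FGJ) Jj) m mn.
set n := (q * 2 ^ j)%N in mn nm *.
have := muN n (leq_trans Nm mn).
rewrite (big_cat_nat (leq0n m) mn)//= sumrN.
move: (\sum_(0 <= k < m) x k) (\sum_(m <= k < n) x k) => A B muN' hB hA.
have := muM n; have := nuM n; move: (mu n) (nu n) muN' hA hB => u v uN hA hB.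
rewrite !ler_norml => /andP[_ vM] /andP[_ uM].
set D := (n - m)%:R in hB.
have nD : n%:R = m%:R + D :> R by rewrite /D natrB// addrC subrK.
have D0 : 0 <= D by [].
have m0 : 0 <= m%:R :> R by [].
have L1 : 1 <= L%:R :> R by rewrite ler1n.
have DL : D * L%:R <= m%:R by rewrite -natrM ler_nat.
have Dm : D <= m%:R by apply: le_trans DL; rewrite ler_peMr.
have DM : D * M <= e * m%:R.
  apply: (@le_trans _ _ (D * (L%:R * e))); first by rewrite ler_wpM2l.
  by rewrite mulrA mulrC ler_wpM2l// ltW.
have Du : D * u <= D * M by rewrite ler_wpM2l.
have Dv : D * v <= D * M by rewrite ler_wpM2l.
have mu' : m%:R * u <= m%:R * (a + e) by rewrite ler_wpM2l.
have pn : p.+1%:R^-1 * n%:R <= e * n%:R by rewrite ler_wpM2r.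
have en : e * n%:R <= 2 * (e * m%:R).
  by rewrite nD mulrDr -[_ * m%:R]/(e * m%:R) mulr_natl mulr2n lerD2l ler_wpM2l// ltW.
clearbody D; rewrite nD in hA pn en hB.
move: (p.+1%:R^-1) (m%:R : R) hA pn en hB mu' DM Du Dv => r y.
lra.
Qed.

Lemma limn_esup_le_EFin (R : realType) (u : nat -> R) (a : R) :
  (forall e, 0 < e -> exists N, forall n, (N <= n)%N -> u n <= a + e) ->
  (limn_esup (fun n => (u n)%:E) <= a%:E)%E.
Proof.
move=> ua; apply/lee_addgt0Pr => e /ua[N uN].
apply: (@le_trans _ _ (ereal_sup [set (u n)%:E | n in [set n | (N <= n)%N]])).
  by apply: ereal_inf_lbound; exists [set n | (N <= n)%N] => //; exists N.
by apply: ge_ereal_sup => _ [n /= Nn <-]; rewrite lee_fin uN.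
Qed.

(** * Strong law of large numbers *)

Section Opposite.
Context {R : realType} {T : Type} {E : (T -> R) -> \bar R}.
Context {X : nat -> T -> R}.

Lemma rvec_opp n (Y : 'I_n -> T -> R) :
  rvec (fun j w => - Y j w) = (fun w => - rvec Y w).
Proof. by apply/funext => w; apply/rowP => i; rewrite !mxE. Qed.

Lemma neg_dependent_seq_opp : neg_dependent_seq E X ->
  neg_dependent_seq E (fun n w => - X n w).
Proof.
move=> hnd i phi1 phi2 l1 l2; rewrite !rvec_opp => p1 p2 f12 f1 f2 mono.
apply: (hnd i _ _ (cl_lip_opp l1) (cl_lip_opp l2) p1 p2 f12 f1 f2).
have flip n (phi : 'rV[R]_n -> R) :
    (coord_nondecreasing phi -> coord_nonincreasing (fun v => phi (- v))) /\
    (coord_nonincreasing phi -> coord_nondecreasing (fun v => phi (- v))).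
  by split => h x y xy; apply: h => k; rewrite !mxE lerN2.
by case: mono => -[m1 m2]; [right|left]; split; apply (flip _ _).
Qed.

Lemma identically_distributed_opp : identically_distributed E X ->
  identically_distributed E (fun n w => - X n w).
Proof.
by move=> hid i phi l /=; rewrite !rvec_opp; exact: (hid i _ (cl_lip_opp l)).
Qed.

End Opposite.

Section StrongLaw.
Context {R : realType} {d : measure_display} {T : measurableType d}.
Context {H : set (T -> R)} {E : (T -> R) -> \bar R}.
Context (hE : sublinear_expectation_space H E).

Local Notation mean := (@mean R d T E).
Local Notation L1 := (@rv_L1 R d T H E).
Local Notation V := (capacity H E).
Local Notation Vext := (outer_capacity H E).

Lemma rv_L1_excess c (Y : T -> R) : L1 Y -> L1 (fun w => Num.max (`|Y w| - c) 0).
Proof.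
move=> LY; apply: (rv_L1_le hE (Y := fun w => `|Y w| + `|c|)).
- have lf : lipR (fun z : R => Num.max (`|z| + - c) 0).
    exact/lipR_max/(lipR_add _ (lipR_cst _))/lipR_norm/lipR_id.
  exact: (rv_lipR hE (rv_L1_H LY) lf).
- move=> w; have := normr_ge0 (Y w); have := normr_ge0 c; have := ler_norm (- c).
  rewrite normrN; move: `|Y w| `|c| => y z h0 h1 h2; rewrite /Num.max; case: ltP => h3.
    by rewrite normr0; lra.
  by rewrite ger0_norm; lra.
- exact: (rv_L1_add hE (rv_L1_norm hE LY) (rv_L1_cst hE _)).
Qed.

(** Because [|Y| <= Num.max (|Y| - c) 0 + c]. *)
Lemma rv_L1_of_excess c (Y : T -> R) : H Y ->
  (E (fun w => Num.max (`|Y w| - c) 0)%R < +oo)%E -> L1 Y.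
Proof.
move=> HY Yc.
have lf : lipR (fun z : R => Num.max (`|z| + - c) 0).
  exact/lipR_max/(lipR_add _ (lipR_cst _))/lipR_norm/lipR_id.
have LM : L1 (fun w => Num.max (`|Y w| - c) 0).
  split; first exact: (rv_lipR hE HY lf).
  by under eq_fun do rewrite (ger0_norm (_ : 0 <= Num.max _ 0)) ?le_max ?lexx ?orbT//.
apply: (rv_L1_le hE HY _ (rv_L1_add hE LM (rv_L1_cst hE c))) => w.
by rewrite -lerBlDr le_max lexx.
Qed.

Section OneSided.
Context {X : nat -> T -> R} (hX : forall n, H (X n)).
Context (hid : identically_distributed E X) (hnd : neg_dependent_seq E X).
Context (L1X : L1 (X 0%N)).
Context (choquetX : (choquet V (fun w => `|X 0%N w|)%R < +oo)%E).
Context (excessX : forall e, 0 < e -> exists N, forall n, (N <= n)%N ->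
  mean (fun w => Num.max (`|X 0%N w| - n%:R) 0) <= e).

(** Clipping changes [X 0] by exactly the excess over [n], whose mean tends
    to 0. *)
Lemma clipped_mean_le e : 0 < e -> exists N, forall n, (N <= n)%N ->
  @clipped_mean R d T E X n <= mean (X 0%N) + e.
Proof.
move=> /excessX[N XN]; exists N => n /XN Xn.
have LC : L1 (fun w => clip n%:R (X 0%N w)) by apply: (rv_L1_clip hE).
rewrite -lerBlDl; apply: le_trans (mean_sub hE LC L1X) _; apply: le_trans Xn.
apply: (mean_le hE) => [||w]; [exact: (rv_L1_sub hE)|exact: rv_L1_excess|].
by rewrite -dist_clip// distrC ler_norm.
Qed.

(** The exceptional set is a countable union, over the ratios [q.+1] and the
    precisions [1 / (p + 1)], of the negligible sets provided by the first
    Borel-Cantelli lemma for [X] and for [- X]. *)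
Lemma limsup_average_le :
  Vext [set w | (E (X 0%N) < limn_esup (fun n => (psum X n w / n%:R)%:E))%E] = 0%E.
Proof.
pose bad (Y : nat -> T -> R) (q p : nat) := [set w | forall N, exists2 j, (N <= j)%N &
  1 <= @deviation R d T E Y p.+1%:R^-1 (q.+1 * 2 ^ j) w].
pose Xo n w := - X n w.
have p0 p : 0 < p.+1%:R^-1 :> R by rewrite invr_gt0.
have choquetXo : (choquet V (fun w => `|Xo 0%N w|)%R < +oo)%E.
  by under eq_fun do rewrite normrN.
have hXo n : H (Xo n) by exact: (rv_opp hE).
have hido := identically_distributed_opp hid.
have hndo := neg_dependent_seq_opp hnd.
have L1Xo : L1 (Xo 0%N) by exact: (rv_L1_opp hE).
have badX q p : Vext (bad X q p) = 0%E.
  exact: (deviation_null hE hX hid hnd L1X _ (p0 p)).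
have badXo q p : Vext (bad Xo q p) = 0%E.
  exact: (deviation_null hE hXo hido hndo L1Xo _ (p0 p)).
apply: (outer_capacity_null_sub hE (B :=
  \bigcup_q \bigcup_p (bad X q p `|` bad Xo q p))); last first.
  apply: (outer_capacity_null_bigcup hE) => q.
  by apply: (outer_capacity_null_bigcup hE) => p; exact: (outer_capacity_nullU hE).
move=> w /=; rewrite (meanE hE L1X); apply: contraPP => good; apply/negP; rewrite -leNgt.
have goodY (Y : nat -> T -> R) : (forall q p, ~ bad Y q p w) ->
    forall q p, (0 < q)%N -> exists N, forall j, (N <= j)%N ->
    @deviation R d T E Y p.+1%:R^-1 (q * 2 ^ j) w < 1.
  move=> Yw [//|q] p _; have /existsNP[N hN] := Yw q p.
  by exists N => j Nj; rewrite ltNge; apply/negP => h; apply: hN; exists j.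
have goodX := goodY X (fun q p h => good (ex_intro2 _ _ q I (ex_intro2 _ _ p I (or_introl h)))).
have goodXo := goodY Xo (fun q p h => good (ex_intro2 _ _ q I (ex_intro2 _ _ p I (or_intror h)))).
have pow0 q j : (0 < q)%N -> (0 < q * 2 ^ j)%N by move=> q0; rewrite muln_gt0 q0 expn_gt0.
have M_o : mean (fun w => `|Xo 0%N w|) = mean (fun w => `|X 0%N w|).
  by congr mean; apply/funext => z; rewrite normrN.
apply: limn_esup_le_EFin => e e0.
have [||||N XN] := @partial_sum_le R (X^~ w) (@clipped_mean R d T E X)
  (@clipped_mean R d T E Xo) (mean (X 0%N)) (mean (fun w => `|X 0%N w|)) _ _
  clipped_mean_le _ _ e e0.
- by move=> n; exact: (abs_clipped_mean_le hE).
- by move=> n; rewrite -M_o; exact: (abs_clipped_mean_le hE).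
- move=> q p q0; have [N hN] := goodX q p q0; exists N => j /hN h.
  by have := backward_sum_le (p0 p) (pow0 q j q0) (leq0n _) h; rewrite subn0.
- move=> q p q0; have [N hN] := goodXo q p q0; exists N => j /hN h m mn.
  exact: (backward_sum_le (p0 p) (pow0 q j q0) mn h).
exists N.+1 => n Nn; have n0 : 0 < n%:R :> R by rewrite ltr0n (leq_trans _ Nn).
by rewrite ler_pdivrMr// mulrC /psum -(big_mkord xpredT (fun k => X k w)) XN// ltnW.
Qed.

End OneSided.

Lemma strong_law (X : nat -> T -> R) : (forall n, H (X n)) ->
  identically_distributed E X -> neg_dependent_seq E X ->
  (choquet V (fun w => `|X 0%N w|)%R < +oo)%E ->
  E (fun w => Num.max (`|X 0%N w| - c) 0)%R @[c --> +oo%R] --> 0%E ->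
  Vext ([set w | (limn_einf (fun n => (psum X n w / n%:R)%:E)
                  < conj_expectation E (X 0%N))%E] `|`
        [set w | (limn_esup (fun n => (psum X n w / n%:R)%:E)
                  > E (X 0%N))%E]) = 0%E.
Proof.
move=> hX hid hnd Xoo excess.
have excess_lt (e : R) : 0 < e -> exists M : R, forall c, M < c ->
    (E (fun w => Num.max (`|X 0%N w| - c) 0)%R < e%:E)%E.
  move=> e0; have /excess : nbhs (0%E : \bar R) [set x | (x < e%:E)%E].
    by apply: open_nbhs_nbhs; split; [exact: open_ereal_lt_ereal|rewrite /= lte_fin].
  by move=> [M [_ hM]]; exists M.
have L1X : L1 (X 0%N).
  have [M hM] := excess_lt 1 ltr01.
  apply: (rv_L1_of_excess (c := M + 1) (hX 0)).
  by rewrite (lt_trans (hM _ _)) ?ltry// ltrDl.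
have excessN e : 0 < e -> exists N, forall n, (N <= n)%N ->
    mean (fun w => Num.max (`|X 0%N w| - n%:R) 0) <= e.
  move=> /excess_lt[M hM]; exists (Num.truncn M).+1 => n Mn.
  rewrite -lee_fin -(meanE hE (rv_L1_excess _ L1X)); apply/ltW/hM.
  by rewrite (lt_le_trans (truncnS_gt _))// ler_nat.
apply: (outer_capacity_nullU hE); last exact: limsup_average_le.
have absN : (fun w => `|- X 0%N w|) = (fun w => `|X 0%N w|).
  by apply/funext => w; rewrite normrN.
have XNoo : (choquet V (fun w => `|- X 0%N w|)%R < +oo)%E by rewrite absN.
have excessNN e : 0 < e -> exists N, forall n, (N <= n)%N ->
    mean (fun w => Num.max (`|- X 0%N w| - n%:R) 0) <= e.
  by move=> /excessN[N hN]; exists N => n /hN; under eq_fun do rewrite -normrN.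
have := @limsup_average_le (fun n w => - X n w) (fun n => rv_opp hE (hX n))
  (identically_distributed_opp hid) (neg_dependent_seq_opp hnd)
  (rv_L1_opp hE L1X) XNoo excessNN.
congr (_ = _); congr Vext; apply/funext => w /=.
rewrite /limn_einf /conj_expectation lteN2.
congr (is_true (_ < limn_esup _)%E); apply/funext => n.
by rewrite /psum sumrN mulNr.
Qed.

End StrongLaw.

(** * Products of independent variables *)

Section Products.
Context {R : realType}.

Lemma prod_unit_interval n (a : nat -> R) : (forall j, 0 <= a j <= 1) ->
  0 <= \prod_(j < n) a j <= 1.
Proof.
move=> a01; rewrite prodr_ge0 => [|j _]; last by have /andP[] := a01 j.
by rewrite /= prodr_ile1.
Qed.

Lemma dist_prod_le n (a b : nat -> R) :
  (forall j, 0 <= a j <= 1) -> (forall j, 0 <= b j <= 1) ->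
  `|\prod_(j < n) a j - \prod_(j < n) b j| <= \sum_(j < n) `|a j - b j|.
Proof.
move=> a01 b01; elim: n => [|n IH]; first by rewrite !big_ord0 subrr normr0.
rewrite !big_ord_recr/=; have /andP[an0 an1] := a01 n.
have /andP[B0 B1] := prod_unit_interval n b01.
move: (\prod_(j < n) a j) (\prod_(j < n) b j) IH B0 B1 => A B IH B0 B1.
have -> : A * a n - B * b n = (A - B) * a n + B * (a n - b n) by ring.
apply: le_trans (ler_normD _ _) _; rewrite !normrM; apply: lerD.
  by apply: le_trans IH; rewrite ler_piMr// ger0_norm.
by rewrite ler_piMl// ger0_norm.
Qed.

Lemma cl_lip_prod n (h : nat -> R -> R) : (forall j, lipR (h j)) ->
  (forall j z, 0 <= h j z <= 1) ->
  cl_lip (fun v : 'rV[R]_n => - \prod_(j < n) h j (v ord0 j)).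
Proof.
case: n => [|n] lh h01.
  by apply: (@cl_lip_coord _ _ _ 0) => x y; rewrite !big_ord0 subrr normr0 mul0r.
have [C hC] := choice (fun j => lh j).
apply: (@cl_lip_coord _ _ _ (\sum_(j < n.+1) `|C j|)) => x y.
rewrite -opprD normrN.
have inordE (v : 'rV[R]_n.+1) :
    \prod_(j < n.+1) h j (v ord0 j) = \prod_(j < n.+1) h j (v ord0 (inord j)).
  by apply: eq_bigr => j _; rewrite inord_val.
rewrite !inordE.
apply: le_trans (@dist_prod_le n.+1 (fun j => h j (x ord0 (inord j)))
  (fun j => h j (y ord0 (inord j))) _ _) _ => //.
rewrite mulr_sumr; apply: ler_sum => j _; rewrite inord_val.
apply: le_trans (hC j _ _) _; apply: ler_wpM2r => //.
by rewrite (le_trans (ler_norm _))// (bigD1 j)//= lerDl sumr_ge0.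
Qed.

(** An elementary substitute for [\prod (1 - e j) <= exp (- \sum e j)]. *)
Lemma prod_1sub_le n (e : nat -> R) : (forall j, 0 <= e j <= 1) ->
  \prod_(j < n) (1 - e j) * (1 + \sum_(j < n) e j) <= 1.
Proof.
move=> e01; elim: n => [|n IH]; first by rewrite !big_ord0 addr0 mulr1.
rewrite !big_ord_recr/=; have /andP[e0 e1] := e01 n.
have P0 : 0 <= \prod_(j < n) (1 - e j).
  by apply: prodr_ge0 => j _; have /andP[_] := e01 j; rewrite subr_ge0.
have S0 : 0 <= \sum_(j < n) e j.
  by apply: sumr_ge0 => j _; have /andP[] := e01 j.
apply: le_trans IH; rewrite -mulrA ler_wpM2l//.
move: (\sum_(j < n) e j) (e n) S0 e0 e1 => s t s0 t0 t1.
by have := mulr_ge0 s0 t0; have := mulr_ge0 t0 t0; lra.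
Qed.

End Products.

Section Independence.
Context {R : realType} {d : measure_display} {T : measurableType d}.
Context {H : set (T -> R)} {E : (T -> R) -> \bar R}.
Context (hE : sublinear_expectation_space H E).
Context {X : nat -> T -> R} (hX : forall n, H (X n)).
Context (hind : independent_seq H E X).

Local Notation mean := (@mean R d T E).
Local Notation L1 := (@rv_L1 R d T H E).
Local Notation V := (capacity H E).
Local Notation Vext := (outer_capacity H E).

Lemma rv_L1_prod n (h : nat -> R -> R) : (forall j, lipR (h j)) ->
  (forall j z, 0 <= h j z <= 1) -> L1 (fun w => \prod_(j < n) h j (X j w)).
Proof.
move=> lh h01; apply: (rv_L1_bounded hE (M := 1)).
  by apply: (@rv_prod _ _ _ _ _ hE n (fun j w => h j (X j w))) => j; exact: (rv_lipR hE).
move=> w; have /andP[p0 p1] := prod_unit_interval n (fun j => h01 j (X j w)).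
by rewrite ger0_norm.
Qed.

Lemma rv_L1_unit_interval (f : R -> R) i : lipR f -> (forall z, 0 <= f z <= 1) ->
  L1 (fun w => f (X i w)).
Proof.
move=> lf f01; apply: (rv_L1_lipR hE hX i lf (B := 1)) => z.
by have /andP[f0 f1] := f01 z; rewrite ger0_norm.
Qed.

(** For [phi (x, y) = - (F x * h y)] with [0 <= F] and [Y = h (X n)], the inner
    expectation is [F x * mean (- Y)] by positive homogeneity, so the nested
    expectation factors. The minus signs are essential: they turn the product
    rule into one for the conjugate expectation, which sees the complements
    [1 - gate] of the events. *)
Lemma independent_mean_prod n (h : nat -> R -> R) : (forall j, lipR (h j)) ->
  (forall j z, 0 <= h j z <= 1) ->
  - mean (fun w => - \prod_(j < n) h j (X j w)) =
  \prod_(j < n) - mean (fun w => - h j (X j w)).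
Proof.
move=> lh h01; case: n => [|i].
  under eq_fun do rewrite big_ord0.
  by rewrite (mean_cst hE) opprK big_ord0.
elim: i => [|i IH].
  under eq_fun do rewrite big_ord_recr big_ord0/= mul1r.
  by rewrite big_ord_recr big_ord0/= mul1r.
rewrite big_ord_recr/= -IH.
pose phi (v : 'rV[R]_(i.+1 + 1)) := - \prod_(j < i.+1 + 1) h j (v ord0 j).
pose F (x : 'rV[R]_i.+1) := \prod_(j < i.+1) h j (x ord0 j).
pose Y w := h i.+1 (X i.+1 w).
have F0 x : 0 <= F x by apply: prodr_ge0 => j _; have /andP[] := h01 j (x ord0 j).
have phiE x w : phi (row_mx x (rvec (fun _ : 'I_1 => X i.+1) w)) = - (F x * Y w).
  rewrite /phi big_split_ord/= [X in _ * X]big_ord_recl [X in _ * (_ * X)]big_ord0 mulr1.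
  congr (- (_ * _)); first by apply: eq_bigr => j _; rewrite row_mxEl.
  by rewrite row_mxEr mxE/= /Y addn0.
have FX w : F (rvec (fun j : 'I_i.+1 => X j) w) = \prod_(j < i.+1) h j (X j w).
  by apply: eq_bigr => j _; rewrite mxE.
have LY : L1 Y by exact: rv_L1_unit_interval.
have Y0 w : 0 <= Y w by have /andP[] := h01 i.+1 (X i.+1 w).
have LP := rv_L1_prod i.+1 lh h01.
have barE x : E (fun w => `|phi (row_mx x (rvec (fun _ : 'I_1 => X i.+1) w))|) =
    (F x * mean Y)%:E.
  under eq_fun do rewrite phiE normrN ger0_norm ?mulr_ge0//.
  by rewrite (meanE hE) ?(mean_scale hE)//; exact: (rv_L1_scale hE).
have gE x : E (fun w => phi (row_mx x (rvec (fun _ : 'I_1 => X i.+1) w))) =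
    (F x * mean (fun w => - Y w))%:E.
  have LNY : L1 (fun w => - Y w) by exact: (rv_L1_opp hE).
  under eq_fun do rewrite phiE -mulrN.
  by rewrite (meanE hE) ?(mean_scale hE)//; exact: (rv_L1_scale hE).
have LPc c : L1 (fun w => (\prod_(j < i.+1) h j (X j w)) * c).
  by under eq_fun do rewrite mulrC; exact: (rv_L1_scale hE).
have step : E (fun w => phi (row_mx (rvec (fun j : 'I_i.+1 => X j) w)
      (rvec (fun _ : 'I_1 => X i.+1) w))) =
    E (fun w => fine (E (fun z => phi (row_mx (rvec (fun j : 'I_i.+1 => X j) w)
      (rvec (fun _ : 'I_1 => X i.+1) z))))).
  apply: hind => /=; first exact: cl_lip_prod.
  - by move=> x; rewrite barE ltry.
  - by under eq_fun do rewrite barE/= FX; exact: rv_L1_H (LPc _).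
  - by under eq_fun do rewrite gE/= FX; exact: rv_L1_H (LPc _).
  - by under eq_fun do rewrite barE/= FX; case: (LPc (mean Y)).
move: step; under eq_fun do rewrite phiE FX.
under [X in _ = E X -> _]eq_fun do rewrite gE/= FX.
move=> step.
have -> : (fun w => - \prod_(j < i.+2) h j (X j w)) =
    (fun w => - (\prod_(j < i.+1) h j (X j w) * Y w)).
  by apply/funext => w; rewrite big_ord_recr.
rewrite /mean step -/(mean _).
set l := - mean (fun w => - h i.+1 (X i.+1 w)).
have l0 : 0 <= l.
  rewrite oppr_ge0; apply: (mean_le_cst hE); first exact: (rv_L1_opp hE).
  by move=> w; rewrite oppr_le0 Y0.
have -> : (fun w => \prod_(j < i.+1) h j (X j w) * mean (fun z => - Y z)) =
    (fun w => l * - \prod_(j < i.+1) h j (X j w)).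
  by apply/funext => w; rewrite /l mulrNN mulrC.
rewrite (mean_scale hE l0); last exact: (rv_L1_opp hE LP).
by clearbody l; rewrite mulNr mulrC.
Qed.

(** Analytic core of the second Borel-Cantelli lemma: for [g j] below an indicator,
    [1 - \prod (1 - g j (X j))] is below the indicator of the union of the
    events, and its mean is [1 - \prod (1 - mean (g j (X j)))] because the
    conjugate expectation of the product factors. *)
Lemma mean_one_sub_prod_ge (g : nat -> R -> R) (e : R) : (forall j, lipR (g j)) ->
  (forall j z, 0 <= g j z <= 1) ->
  (forall C, exists N, C < \sum_(j < N) mean (fun w => g j (X j w))) -> 0 < e ->
  exists N, 1 - e <= mean (fun w => 1 - \prod_(j < N) (1 - g j (X j w))).
Proof.
move=> lg g01 sum_oo e0; have [N eN] := sum_oo e^-1; exists N.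
pose h j z := 1 - g j z.
have lh j : lipR (h j).
  have := lipR_add (lipR_cst 1) (lipR_scale (-1) (lg j)).
  by under eq_fun do rewrite mulN1r.
have h01 j z : 0 <= h j z <= 1.
  by have /andP[g0 g1] := g01 j z; rewrite subr_ge0 g1 gerBl g0.
have Lg j : L1 (fun w => g j (X j w)) by exact: rv_L1_unit_interval.
have lE j : - mean (fun w => - h j (X j w)) = 1 - mean (fun w => g j (X j w)).
  under eq_fun do rewrite opprB.
  by rewrite (mean_addc hE) ?opprB.
have mean01 j : 0 <= mean (fun w => g j (X j w)) <= 1.
  rewrite (mean_ge0 hE)//= => [|w]; last by have /andP[] := g01 j (X j w).
  by apply: (mean_le_cst hE) => // w; have /andP[] := g01 j (X j w).
have := independent_mean_prod N lh h01; under [RHS]eq_bigr do rewrite lE.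
have -> : (fun w => 1 - \prod_(j < N) (1 - g j (X j w))) =
    (fun w => - \prod_(j < N) h j (X j w) + 1).
  by apply/funext => w; rewrite addrC.
rewrite (mean_addc hE); last exact/(rv_L1_opp hE)/rv_L1_prod.
have := prod_1sub_le N mean01.
move: (\prod_(j < N) (1 - _)) (\sum_(j < N) _) (mean _) eN => p s m es ps pm.
have p0 : p <= e.
  rewrite -[leRHS]invrK; have s0 : 0 < 1 + s.
    by rewrite ltr_wpDl// (lt_trans _ es)// invr_gt0.
  have : p <= (1 + s)^-1 by rewrite -[leRHS]mul1r ler_pdivlMr.
  move=> /le_trans; apply; rewrite lef_pV2 ?posrE ?invr_gt0//.
  by rewrite (le_trans (ltW es))// lerDr.
by lra.
Qed.

End Independence.

(** * Converse of the strong law *)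

Lemma limn_esup_lt_pinfty_bound (R : realType) (u : nat -> R) :
  (limn_esup (fun n => (u n)%:E) < +oo)%E ->
  exists (C : R) (N : nat), forall n, (N <= n)%N -> u n <= C.
Proof.
move=> /ereal_inf_lt[_ [A [N _ NA] <-]] supA.
have ub n : (N <= n)%N -> ((u n)%:E <= ereal_sup [set (u k)%:E | k in A])%E.
  by move=> Nn; apply: ereal_sup_ubound; exists n => //; exact: NA.
case: (ereal_sup _) supA ub => [C _ ub|//|_ ub].
  by exists C, N => n /ub; rewrite lee_fin.
by have := ub N (leqnn N); rewrite leeNy_eq.
Qed.

(** Large terms force large averages: [x n.+1] is the difference of two
    consecutive partial sums. *)
Lemma limsup_average_pinfty (R : realType) (x : nat -> R) :
  (forall m, exists2 n, (m <= n)%N & m.+1%:R * n.+1%:R <= `|x n.+1|) ->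
  limn_esup (fun n => (`|\sum_(k < n) x k| / n%:R)%:E) = +oo%E.
Proof.
move=> x_large; apply/eqP; rewrite eq_le leey/= leNgt; apply/negP.
move=> /limn_esup_lt_pinfty_bound[C [N hC]].
have C0 : 0 <= C by apply: le_trans (hC N (leqnn N)); rewrite divr_ge0.
pose m := maxn N (Num.truncn (3 * C)).
have [n mn xn] := x_large m.
have Cm : 3 * C < m.+1%:R.
  by rewrite (lt_le_trans (truncnS_gt _))// ler_nat ltnS leq_maxr.
have Nn : (N <= n)%N by rewrite (leq_trans _ mn)// leq_maxl.
have sumC k : (N <= k.+1)%N -> `|\sum_(i < k.+1) x i| <= C * k.+1%:R.
  by move=> /hC; rewrite ler_pdivrMr.
have h1 := sumC n (leqW Nn); have h2 := sumC n.+1 (leqW (leqW Nn)).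
have : `|x n.+1| <= 3 * C * n.+1%:R.
  have -> : x n.+1 = \sum_(i < n.+2) x i - \sum_(i < n.+1) x i.
    by rewrite [X in _ = X - _]big_ord_recr/= addrAC subrr add0r.
  apply: le_trans (ler_normB _ _) _; apply: le_trans (lerD h2 h1) _.
  rewrite -[n.+2%:R]natr1 -[n.+1%:R]natr1.
  have : 0 <= C * n%:R by rewrite mulr_ge0.
  by lra.
move=> /(le_trans xn); rewrite ler_pM2r// => /le_lt_trans /(_ Cm).
by rewrite ltxx.
Qed.

Section Converse.
Context {R : realType} {d : measure_display} {T : measurableType d}.
Context {H : set (T -> R)} {E : (T -> R) -> \bar R}.
Context (hE : sublinear_expectation_space H E).
Context {X : nat -> T -> R} (hX : forall n, H (X n)).
Context (hid : identically_distributed E X) (hind : independent_seq H E X).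
Context (hsub : countably_subadditive H E).

Local Notation mean := (@mean R d T E).
Local Notation L1 := (@rv_L1 R d T H E).
Local Notation V := (capacity H E).
Local Notation Vext := (outer_capacity H E).

(** The shift to [n.+1] keeps the thresholds positive; the factor [m.+1] makes
    the intersection over [m] an event of unbounded ratios [|X n| / n]. *)
Definition large_from (m : nat) : set T :=
  \bigcup_(n in [set n | (m <= n)%N]) [set w | m.+1%:R * n.+1%:R <= `|X n.+1 w|].

Lemma measurable_large_from m : measurable (large_from m).
Proof.
apply: bigcup_measurable => n _; rewrite -[X in measurable X]setTI.
have := rv_measurable (sles_rv hE) (rv_norm hE (hX n.+1)).
move=> /(_ measurableT _ (measurable_itv `[m.+1%:R * n.+1%:R, +oo[)).
congr (measurable (_ `&` _)); apply/seteqP.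
by split => w /=; rewrite in_itv/= andbT.
Qed.

Lemma large_from_nonincreasing : nonincreasing_seq large_from.
Proof.
apply/nonincreasing_seqP => m; apply/subsetPset => w [n /= mn Xn].
exists n; first by rewrite /= ltnW.
by apply: le_trans Xn; rewrite ler_wpM2r// ler_nat.
Qed.

(** The gates of level [2 * (m + 1) * j] with [j > m] vanish outside [large_from m],
    and the sum of their means diverges when the Choquet integral is infinite. *)
Lemma outer_capacity_large_from m :
  ~ (choquet V (fun w => `|X 0%N w|)%R < +oo)%E -> (1 <= Vext (large_from m))%E.
Proof.
move=> Xoo; pose a : R := 2 * m.+1%:R.
have a0 : 0 < a by rewrite mulr_gt0.
pose g j : R -> R := if (j <= m)%N then fun=> 0 else gate (j%:R * a).
have lg j : lipR (g j).
  by rewrite /g; case: ifP => _; [exact: lipR_cst|exact: lipR_gate].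
have g01 j z : 0 <= g j z <= 1.
  by rewrite /g; case: ifP => _; rewrite ?lexx ?ler01 ?gate_ge0 ?gate_le1.
have gX j : mean (fun w => g j (X j w)) = mean (fun w => g j (X 0%N w)).
  apply: (identically_distributed_mean hE hX j hid (lg j) (B := 1)) => z.
  by have /andP[g0 g1] := g01 j z; rewrite ger0_norm.
have sum_oo C : exists N, C < \sum_(j < N) mean (fun w => g j (X j w)).
  apply: contrapT => /forallNP sumC; apply: Xoo.
  apply: (choquet_lt_pinfty hE (C := m%:R + C) (hX 0) a0) => N.
  have gate01 n : 0 <= mean (fun w => gate (n.+1%:R * a) (X 0%N w)) <= 1.
    have LG := rv_L1_gate hE (n.+1%:R * a) (hX 0).
    rewrite (mean_ge0 hE LG)/= => [|w]; last exact: gate_ge0.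
    by apply: (mean_le_cst hE LG) => w; exact: gate_le1.
  apply: (@le_trans _ _ (\sum_(n < m + N) mean (fun w => gate (n.+1%:R * a) (X 0%N w)))).
    rewrite addnC big_split_ord/= lerDl sumr_ge0// => n _.
    by have /andP[] := gate01 (N + n)%N.
  rewrite big_split_ord/=; apply: lerD.
    rewrite -[leRHS]mulr1 -[m in m%:R]card_ord mulr_natl -sumr_const.
    by apply: ler_sum => n _; have /andP[] := gate01 n.
  have /negP := sumC (m.+1 + N)%N; rewrite -leNgt; apply: le_trans.
  rewrite big_split_ord/= [X in _ <= X + _]big1 ?add0r => [|n _]; last first.
    rewrite gX /g -ltnS ltn_ord; under eq_fun do [].
    exact: (mean_cst hE).
  apply: ler_sum => n _; rewrite gX /g addSn ltnNge leq_addr//.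
apply/lee_addgt0Pr => e e0.
have [N] := mean_one_sub_prod_ge hE hX hind lg g01 sum_oo e0.
set eta := fun w => 1 - _; move=> eN.
have h01 w : 0 <= \prod_(j < N) (1 - g j (X j w)) <= 1.
  apply: (prod_unit_interval N (a := fun j => 1 - g j (X j w))) => j.
  by have /andP[g0 g1] := g01 j (X j w); rewrite subr_ge0 g1 gerBl g0.
have Leta : L1 eta.
  apply: (rv_L1_sub hE (rv_L1_cst hE 1)).
  apply: (rv_L1_prod hE hX N (h := fun j z => 1 - g j z)) => j.
    have := lipR_add (lipR_cst 1) (lipR_scale (-1) (lg j)).
    by under eq_fun do rewrite mulN1r.
  by move=> z; have /andP[g0 g1] := g01 j z; rewrite subr_ge0 g1 gerBl g0.
have : ((mean eta)%:E <= Vext (large_from m))%E.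
  apply: (mean_le_outer_capacity hE hsub Leta) => w.
    by rewrite subr_ge0; have /andP[] := h01 w.
  rewrite indicE; have [_|] := boolP (w \in large_from m).
    by rewrite gerBl; have /andP[] := h01 w.
  rewrite notin_setE => small; rewrite /eta big1 ?subrr// => j _.
  rewrite /g; case: leqP => [_|mj]; first by rewrite subr0.
  rewrite gate0 ?subr0// ?mulr_gt0 ?ltr0n ?(leq_trans _ mj)//.
  rewrite leNgt; apply/negP => /ltW Xj; apply: small.
  exists j.-1; first by rewrite /= -ltnS prednK// (leq_trans _ mj).
  rewrite /= prednK ?(leq_trans _ mj)//; apply: le_trans Xj.
  by rewrite /a le_eqVlt; apply/orP; left; apply/eqP; field.
move=> etaV; rewrite -leeBlDr//; apply: le_trans etaV.
by rewrite -EFinB lee_fin.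
Qed.

Lemma choquet_finite_of_bounded_averages : continuous_from_above Vext ->
  (Vext [set w | limn_esup (fun n => (`|psum X n w| / n%:R)%:E) = +oo%E] < 1)%E ->
  (choquet V (fun w => `|X 0%N w|)%R < +oo)%E.
Proof.
move=> cont V1; apply/not_notP => Xoo; move: V1; apply/negP; rewrite -leNgt.
apply: (@le_trans _ _ (Vext (\bigcap_m large_from m))); last first.
  apply: le_mu_ext => w wlarge; apply: (@limsup_average_pinfty R (X^~ w)) => m.
  by have [n /= mn Xn] := wlarge m I; exists n.
have lim := cont _ measurable_large_from large_from_nonincreasing.
rewrite -(cvg_lim _ lim)//; apply: lime_ge; first exact/cvgP/lim.
by near=> m; exact: outer_capacity_large_from.
Unshelve. all: by end_near. Qed.

End Converse.

Local Open Scope ereal_scope.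

Theorem theorem3p5 (R : realType) (d : measure_display) (T : measurableType d)
    (H : set (T -> R)) (E : (T -> R) -> \bar R) (X : nat -> T -> R)
    (hE : sublinear_expectation_space H E)
    (hX : forall n, H (X n))
    (hid : identically_distributed E X) :
  ( neg_dependent_seq E X ->
    choquet (capacity H E) (fun w => `|X 0%N w|%R) < +oo ->
    E (fun w => Num.max (`|X 0%N w| - c) 0)%R @[c --> +oo%R] --> 0 ->
    outer_capacity H E
      ([set w | limn_einf (fun n => (psum X n w / n%:R)%:E)
                  < conj_expectation E (X 0%N)] `|`
       [set w | limn_esup (fun n => (psum X n w / n%:R)%:E)
                  > E (X 0%N)]) = 0 )
  /\
  ( independent_seq H E X ->
    continuous_capacity (outer_capacity H E) ->
    countably_subadditive H E ->
    outer_capacity H E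
      [set w | limn_esup (fun n => (`|psum X n w| / n%:R)%:E) = +oo] < 1 ->
    choquet (capacity H E) (fun w => `|X 0%N w|%R) < +oo ).
Proof.
split=> [hnd|hind [_ from_above] hsub]; first exact: strong_law.
exact: choquet_finite_of_bounded_averages.
Qed.
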